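(* Let $(M,\omega)$ be a connected symplectic Fréchet manifold endowed with a symplectic action of a Fréchet Lie group $G$ with Lie algebra $\mathfrak g$, and let $j$ be an almost complex structure on $M$ compatible with $\omega$. Assume that the action has a momentum map $J:M\to\mathfrak g$ with non-equivariance cocycle $\Sigma$ relative to a non-degenerate symmetric positive-definite pairing $\kappa:\mathfrak g\times\mathfrak g\to\mathbb R$. Let $m\in M$ be a critical point of $\|J\|^2_\kappa$, $\|J\|_\kappa^2(x)=\kappa(J(x),J(x))$, such that $j_m$ and $\kappa$ are invariant under $J(m)$. In infinite dimensions, additionally assume: (1) the adjoints of $\operatorname{ad}_\xi:\mathfrak g\to\mathfrak g$ with respect to $\kappa$ exist for all $\xi\in\mathfrak g$; (2) the map $\Sigma_\kappa:\mathfrak g\to\mathfrak g$ defined by $\kappa(\Sigma_\kappa(\xi),\eta)=\Sigma(\xi,\eta)$ exists; (3) the stabilizer $(\mathfrak g_{\mathbb C})_m$ is finite-dimensional. Then $$(\mathfrak g_{\mathbb C})_m=\mathfrak c_m\oplus\bigoplus_{\lambda\neq0}\mathfrak k_\lambda,$$ where: (i) $\mathfrak c_m$ is the subspace of $(\mathfrak g_{\mathbb C})_m$ consisting of all elements that commute with $J(m)$; (ii) $\mathbb C J(m)\subseteq\mathfrak c_m$; (iii) $\mathfrak k_\lambda$ are the eigenspaces of $\mathrm i\operatorname{ad}_{J(m)}$ (on $(\mathfrak g_{\mathbb C})_m$) with eigenvalue $\lambda\in\mathbb R$ (with $\mathfrak k_\lambda=\{0\}$ if $\lambda$ is not an eigenvalue);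 in particular $\mathfrak c_m=\mathfrak k_0$; (iv) $[\mathfrak k_\lambda,\mathfrak k_\mu]\cap(\mathfrak g_{\mathbb C})_m\subseteq\mathfrak k_{\lambda+\mu}$ if $\lambda+\mu$ is an eigenvalue of $\mathrm i\operatorname{ad}_{J(m)}$, and otherwise $[\mathfrak k_\lambda,\mathfrak k_\mu]\cap(\mathfrak g_{\mathbb C})_m=0$; (v) if $\lambda\neq\nu$, then $\mathfrak k_\lambda$ and $\mathfrak k_\nu$ are orthogonal with respect to $\kappa_{\mathbb C}$. If $J$ is $\operatorname{ad}$-equivariant, then the decomposition is refined to $$(\mathfrak g_{\mathbb C})_m=(\mathfrak g_m)_{\mathbb C}\oplus\bigoplus_{\lambda<0}\mathfrak k_\lambda .$$ If, additionally, $\mathfrak g_m$ is a compact subalgebra of $\mathfrak g$, then $(\mathfrak g_m)_{\mathbb C}$ is a maximal reductive complex Lie algebra contained in $(\mathfrak g_{\mathbb C})_m$.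
   Context: Symplectic forms are weak: $\omega$ is closed and $X\mapsto\omega_m(X,\cdot)$ is injective. $\Upsilon_g:M\to M$ is the action of $g\in G$ (a left action); $\xi\cdot m=\frac{d}{dt}|_{t=0}\Upsilon_{\exp(t\xi)}(m)$, and $\mathfrak g_m=\{\xi\in\mathfrak g:\xi\cdot m=0\}$. A momentum map $J:M\to\mathfrak g$ relative to $\kappa$ satisfies $\omega_m(\xi\cdot m,X)+\kappa(T_mJ(X),\xi)=0$ for all $m,X,\xi$; equivariance is not assumed. ''$J$ is $\operatorname{ad}$-equivariant'' means $T_mJ(\xi\cdot m)=[\xi,J(m)]$ for all $\xi,m$. The non-equivariance cocycle is $\Sigma(\xi,\eta)=\kappa(J(m),[\xi,\eta])+\omega_m(\xi\cdot m,\eta\cdot m)$, independent of $m$. A point $m$ is critical for $\|J\|_\kappa^2$ if and only if $J(m)\in\mathfrak g_m$. An almost complex structure is a smooth family of linear maps $j_m:T_mM\to T_mM$ with $j_m^2=-\mathrm{id}$ (no integrability assumed); it is compatible with $\omega$ if $\omega(j\cdot,j\cdot)=\omega$ and $\omega(X,jX)>0$ for $X\neq0$. $j$ is not assumed to be $G$-invariant. Put $\tau_j(g)=T\Upsilon_g\circ j\circ T\Upsilon_{g^{-1}}-j$, $\tau_j'(\xi)=\frac{d}{dt}|_{t=0}\tau_j(\exp(t\xi))$. ''$j_m$ is invariant under $J(m)$'' means $\tau_j'(J(m))_m=0$; ''$\kappa$ is invariant under $J(m)$'' means $\kappa(\operatorname{ad}_{J(m)}\xi,\eta)+\kappa(\xi,\operatorname{ad}_{J(m)}\eta)=0$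 for all $\xi,\eta\in\mathfrak g$. $\mathfrak g_{\mathbb C}=\mathfrak g\oplus\mathrm i\mathfrak g$ carries the complex-bilinear bracket; $\kappa_{\mathbb C}$ is the Hermitian extension of $\kappa$. The infinitesimal action is extended by $(\xi_1+\mathrm i\xi_2)\cdot m=\xi_1\cdot m+j_m(\xi_2\cdot m)$, and $(\mathfrak g_{\mathbb C})_m=\{\zeta\in\mathfrak g_{\mathbb C}:\zeta\cdot m=0\}$; this is a complex subspace but not necessarily a Lie subalgebra. *)

(* Defs.v *)
From HB Require Import structures.
From mathcomp Require Import all_boot all_order all_algebra.
From mathcomp Require Import all_classical all_reals all_analysis.
From mathcomp Require Import complex.

Set Implicit Arguments.
Unset Strict Implicit.
Unset Printing Implicit Defensive.

Import Order.TTheory GRing.Theory Num.Theory.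
Import numFieldTopology.Exports numFieldNormedType.Exports.

Local Open Scope classical_set_scope.
Local Open Scope ring_scope.

Section LinearAlgebra.
Variables (K : fieldType) (V : lmodType K).
Implicit Types (A B W : set V) (T : V -> V).

Definition subspace A : Prop :=
  A 0 /\ forall (a : K) x y, A x -> A y -> A (a *: x + y).

Definition lin_span A : set V :=
  [set v | exists s : seq (K * V),
     (forall p, p \in s -> A p.2) /\ v = \sum_(p <- s) p.1 *: p.2].

Definition finite_dim A : Prop :=
  exists b : seq V, A `<=` lin_span [set` b].

Definition eigenspace_on W T (a : K) : set V :=
  [set v | W v /\ T v = a *: v].

Definition is_eigenvalue_on W T (a : K) : Prop :=
  exists2 v, v != 0 & eigenspace_on W T a v.

(* W = A (+) (direct sum of the F i over the i in P), internally; the second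
   sum is algebraic, i.e. made of finite sums. *)
Definition is_direct_sum (I : choiceType) W A (P : set I) (F : I -> set V) :
    Prop :=
  [/\ subspace A, forall i, P i -> subspace (F i),
      W = [set w | exists a (s : seq I) (v : I -> V),
             [/\ A a, uniq s, forall i, i \in s -> P i /\ F i (v i)
               & w = a + \sum_(i <- s) v i]]
    & forall a (s : seq I) (v : I -> V),
        A a -> uniq s -> (forall i, i \in s -> P i /\ F i (v i)) ->
        a + \sum_(i <- s) v i = 0 ->
        a = 0 /\ forall i, i \in s -> v i = 0].

Variable br : V -> V -> V.

Definition lie_algebra_axioms : Prop :=
  [/\ forall x, linear (br x),
      forall y, linear (br^~ y),
      forall x, br x x = 0
    & forall x y z, br x (br y z) + br y (br z x) + br z (br x y) = 0].

Definition bracket_span A B : set V :=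
  lin_span [set z | exists x y, [/\ A x, B y & z = br x y]].

Definition lie_subalgebra A : Prop :=
  subspace A /\ forall x y, A x -> A y -> A (br x y).

Definition lie_ideal A B : Prop :=
  [/\ subspace B, B `<=` A & forall x y, A x -> B y -> B (br x y)].

(* Every ideal has a complementary ideal, i.e. the adjoint representation is
   completely reducible. *)
Definition reductive A : Prop :=
  lie_subalgebra A /\
  forall B, lie_ideal A B -> exists B',
    [/\ lie_ideal A B', B `&` B' = [set 0]
      & forall x, A x -> exists y z, [/\ B y, B' z & x = y + z]].

End LinearAlgebra.

(* Compact in the intrinsic sense: an ad-invariant inner product exists. For a
   finite-dimensional real Lie algebra this is equivalent to being the Lie
   algebra of a compact Lie group. *)
Definition compact_subalgebra (R : realType) (V : lmodType R)
    (br : V -> V -> V) (A : set V) : Prop :=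
  [/\ lie_subalgebra br A, finite_dim A &
    exists B : V -> V -> R,
      [/\ forall a x y z, A x -> A y -> A z ->
            B (a *: x + y) z = a * B x z + B y z,
          forall x y, A x -> A y -> B x y = B y x,
          forall x, A x -> x != 0 -> 0 < B x x
        & forall x y z, A x -> A y -> A z ->
            B (br x y) z + B y (br x z) = 0]].

(* V (+) iV; the pair (x, y) stands for x + i y. *)
Definition complexification (R : realType) (V : lmodType R) : Type :=
  (V * V)%type.

Section Complexification.
Variables (R : realType) (V : lmodType R).
Notation VC := (complexification V).

HB.instance Definition _ := GRing.Zmodule.copy VC (V * V)%type.

Definition complexification_scale (z : R[i]) (v : VC) : VC :=
  (complex.Re z *: v.1 - complex.Im z *: v.2,
   complex.Re z *: v.2 + complex.Im z *: v.1).

Fact complexification_scaleA z w v :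
  complexification_scale z (complexification_scale w v) =
  complexification_scale (z * w) v.
Proof.
case: z w => [a b] [c d]; congr (_, _) => /=;
  rewrite !(scalerBl, scalerBr, scalerDr, scalerDl) !scalerA ?opprD -!addrA;
  by congr (_ + _); rewrite [LHS]addrA [LHS]addrC.
Qed.

Fact complexification_scale1 : left_id 1 complexification_scale.
Proof. by case=> a b; congr (_, _); rewrite /= !scale1r scale0r ?subr0 ?addr0. Qed.

Fact complexification_scaleDr :
  right_distributive complexification_scale +%R.
Proof.
move=> z [a b] [c d]; congr (_, _) => /=; rewrite !scalerDr ?opprD;
  by rewrite addrACA.
Qed.

Fact complexification_scaleDl v :
  {morph complexification_scale^~ v : z w / z + w}.
Proof.
case: v => [a b] [x y] [z w]; congr (_, _) => /=; rewrite !scalerDl ?opprD;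
  by rewrite addrACA.
Qed.

HB.instance Definition _ := GRing.Zmodule_isLmodule.Build R[i] VC
  complexification_scaleA complexification_scale1 complexification_scaleDr
  complexification_scaleDl.

Definition toVC (x : V) : VC := (x, 0).

Definition complexify_set (A : set V) : set VC :=
  [set z | A z.1 /\ A z.2].

Definition bracketC (br : V -> V -> V) (z w : VC) : VC :=
  (br z.1 w.1 - br z.2 w.2, br z.1 w.2 + br z.2 w.1).

Definition iad (br : V -> V -> V) (x : V) (z : VC) : VC :=
  (Complex 0 1 : R[i]) *: bracketC br (toVC x) z.

(* The Hermitian extension of a real symmetric form, antilinear in the second
   argument. *)
Definition hermitian_ext (kappa : V -> V -> R) (z w : VC) : R[i] :=
  Complex (kappa z.1 w.1 + kappa z.2 w.2) (kappa z.2 w.1 - kappa z.1 w.2).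

End Complexification.

Section Calculus.
Variable R : realType.

(* The completeness condition does not use the library's [entourage]: the
   uniformity of a [tvsType] induces the topology, but need not be the
   translation-invariant one. *)
Definition frechet_space (E : tvsType R) : Prop :=
  [/\ hausdorff_space E,
      exists B : nat -> set E,
        (forall n, nbhs 0 (B n)) /\
        forall U : set E, nbhs 0 U -> exists n, B n `<=` U
    & forall u : nat -> E,
        (forall U : set E, nbhs 0 U -> exists N, forall p q,
           (N <= p)%N -> (N <= q)%N -> U (u p - u q)) ->
        exists l : E, u @ \oo --> l].

Definition dquot (E F : tvsType R) (f : E -> F) (a v : E) (h : R) : F :=
  h^-1 *: (f (a + h *: v) - f a).

(* The directional derivative, with value 0 where the limit does not exist. The
   library's [derive] is for normed modules only. *)
Definition dderive (E F : tvsType R) (f : E -> F) (a v : E) : F :=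
  xget 0 [set l : F | dquot f a v @ 0^' --> l].

(* f is C^n on the open set U in the sense of Michal-Bastiani. *)
Fixpoint Cn (n : nat) (E F : tvsType R) (U : set E) (f : E -> F) : Prop :=
  (forall x, U x -> {for x, continuous f}) /\
  if n is n'.+1 then
    (forall x v, U x -> exists l : F, dquot f x v @ 0^' --> l) /\
    Cn n' (U `*` [set: E]) (fun p : E * E => dderive f p.1 p.2)
  else True.

Definition smooth_on (E F : tvsType R) (U : set E) (f : E -> F) : Prop :=
  forall n, Cn n U f.

End Calculus.

(* [bwd] is used on the image of the domain only. *)
Record chart (M E : topologicalType) := Chart {
  dom : set M;
  fwd : M -> E;
  bwd : E -> M;
  open_dom : open dom;
  open_img : open (fwd @` dom);
  fwdK : forall x, dom x -> bwd (fwd x) = x;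
  fwd_continuous : forall x, dom x -> {for x, continuous fwd};
  bwd_continuous : forall u, (fwd @` dom) u -> {for u, continuous bwd} }.

Definition img (M E : topologicalType) (c : chart M E) : set E :=
  fwd c @` dom c.

(* An atlas with, for each point x, a preferred chart around x. All tangent
   spaces T_x M are identified with the model space E through the preferred
   charts. *)
Record charted_space (M E : topologicalType) := ChartedSpace {
  atlas : set (chart M E);
  chart_at : M -> chart M E;
  chart_at_atlas : forall x, atlas (chart_at x);
  mem_chart_at : forall x, dom (chart_at x) x }.

Section ModelChart.
Variable E : topologicalType.

Fact model_open_img : open ((id : E -> E) @` [set: E]).
Proof. by rewrite image_id; exact: openT. Qed.

Definition model_chart : chart E E :=
  @Chart E E setT id id openT model_open_img
    (fun _ _ => erefl) (fun x _ => @cvg_id _ _) (fun x _ => @cvg_id _ _).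

Definition model_space : charted_space E E :=
  @ChartedSpace E E [set model_chart] (fun=> model_chart)
    (fun=> erefl) (fun=> I).

End ModelChart.

Section Product.
Variables (M N E F : topologicalType).

Fact open_setX (S T : topologicalType) (A : set S) (B : set T) :
  open A -> open B -> open (A `*` B).
Proof.
rewrite !openE => oA oB [x y] [/= Ax By].
by exists (A, B) => //; split; [exact: oA|exact: oB].
Qed.

Section ProdChart.
Variables (c : chart M E) (d : chart N F).
Let f (p : M * N) : E * F := (fwd c p.1, fwd d p.2).
Let g (p : E * F) : M * N := (bwd c p.1, bwd d p.2).

Fact prod_img : f @` (dom c `*` dom d) = img c `*` img d.
Proof.
apply/seteqP; split=> [_ [[x y] [/= cx dy] <-]|[u v] [/= [x cx <-] [y dy <-]]].
  by split; [exists x|exists y].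
by exists (x, y).
Qed.

Fact prod_open_dom : open (dom c `*` dom d).
Proof. by apply: open_setX; exact: open_dom. Qed.

Fact prod_open_img : open (f @` (dom c `*` dom d)).
Proof. by rewrite prod_img; apply: open_setX; exact: open_img. Qed.

Fact prod_fwdK p : (dom c `*` dom d) p -> g (f p) = p.
Proof. by case: p => x y [/= cx dy]; rewrite /g/= !fwdK. Qed.

Fact prod_fwd_continuous p :
  (dom c `*` dom d) p -> {for p, continuous f}.
Proof.
case: p => x y [/= cx dy]; apply: cvg_pair => /=.
  exact: (cvg_comp _ _ (@cvg_fst _ _ (nbhs x) (nbhs y) _) (fwd_continuous cx)).
exact: (cvg_comp _ _ (@cvg_snd _ _ (nbhs x) (nbhs y) _) (fwd_continuous dy)).
Qed.

Fact prod_bwd_continuous q :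
  (f @` (dom c `*` dom d)) q -> {for q, continuous g}.
Proof.
rewrite prod_img; case: q => u v [/= cu dv]; apply: cvg_pair => /=.
  exact: (cvg_comp _ _ (@cvg_fst _ _ (nbhs u) (nbhs v) _) (bwd_continuous cu)).
exact: (cvg_comp _ _ (@cvg_snd _ _ (nbhs u) (nbhs v) _) (bwd_continuous dv)).
Qed.

Definition prod_chart : chart (M * N)%type (E * F)%type :=
  Chart prod_open_dom prod_open_img prod_fwdK
    prod_fwd_continuous prod_bwd_continuous.

End ProdChart.

Variables (mM : charted_space M E) (mN : charted_space N F).

Fact prod_chart_at_atlas (p : M * N) :
  [set prod_chart c d | c in atlas mM & d in atlas mN]
    (prod_chart (chart_at mM p.1) (chart_at mN p.2)).
Proof.
exists (chart_at mM p.1); first exact: chart_at_atlas.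
by exists (chart_at mN p.2) => //; exact: chart_at_atlas.
Qed.

Fact prod_mem_chart_at (p : M * N) :
  dom (prod_chart (chart_at mM p.1) (chart_at mN p.2)) p.
Proof. by split; exact: mem_chart_at. Qed.

Definition prod_charted : charted_space (M * N)%type (E * F)%type :=
  ChartedSpace prod_chart_at_atlas prod_mem_chart_at.

End Product.

Section Manifolds.
Variable R : realType.

Definition frechet_manifold (M : topologicalType) (E : tvsType R)
    (mM : charted_space M E) : Prop :=
  [/\ frechet_space E, hausdorff_space M
    & forall c d, atlas mM c -> atlas mM d ->
        smooth_on (fwd c @` (dom c `&` dom d)) (fwd d \o bwd c)].

Section Maps.
Variables (M N : topologicalType) (E F : tvsType R).
Variables (mM : charted_space M E) (mN : charted_space N F).

Definition smooth_map (f : M -> N) : Prop :=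
  continuous f /\
  forall c d, atlas mM c -> atlas mN d ->
    smooth_on (fwd c @` (dom c `&` f @^-1` dom d)) (fwd d \o f \o bwd c).

Definition tmap (f : M -> N) (x : M) (v : E) : F :=
  dderive (fwd (chart_at mN (f x)) \o f \o bwd (chart_at mM x))
    (fwd (chart_at mM x) x) v.

End Maps.

Section Tensors.
Variables (M : topologicalType) (E : tvsType R) (mM : charted_space M E).

(* T_u (c^-1) : E -> T_x M with x = c^-1 u, and T_x c : T_x M -> E. *)
Definition to_tangent (c : chart M E) (u v : E) : E :=
  tmap (model_space E) mM (bwd c) u v.

Definition of_tangent (c : chart M E) (x : M) (v : E) : E :=
  tmap mM (model_space E) (fwd c) x v.

Definition critical_point (f : M -> R) (x : M) : Prop :=
  forall v, tmap mM (model_space R^o) (f : M -> R^o) x v = 0.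

Definition local_form (omega : M -> E -> E -> R) (c : chart M E)
    (u v w : E) : R^o :=
  omega (bwd c u) (to_tangent c u v) (to_tangent c u w).

Definition symplectic_form (omega : M -> E -> E -> R) : Prop :=
  [/\ forall x v, scalar (omega x v),
      forall x v w, omega x v w = - omega x w v,
      forall c, atlas mM c ->
        smooth_on (img c `*` [set: E * E])
          (fun p : E * (E * E) => local_form omega c p.1 p.2.1 p.2.2),
      forall c, atlas mM c -> forall u, img c u -> forall v1 v2 v3,
        dderive (fun u => local_form omega c u v2 v3) u v1 +
        dderive (fun u => local_form omega c u v3 v1) u v2 +
        dderive (fun u => local_form omega c u v1 v2) u v3 = 0
    & forall x v, (forall w, omega x v w = 0) -> v = 0].

Definition almost_complex_structure (j : M -> E -> E) : Prop :=
  [/\ forall x, linear (j x),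
      forall c, atlas mM c ->
        smooth_on (img c `*` [set: E])
          (fun p : E * E => of_tangent c (bwd c p.1)
             (j (bwd c p.1) (to_tangent c p.1 p.2)))
    & forall x v, j x (j x v) = - v].

Definition compatible (omega : M -> E -> E -> R) (j : M -> E -> E) : Prop :=
  (forall x v w, omega x (j x v) (j x w) = omega x v w) /\
  (forall x v, v != 0 -> 0 < omega x v (j x v)).

End Tensors.

End Manifolds.

#[short(type="preTopologicalGroupType")]
HB.structure Definition PreTopologicalGroup :=
  {G of Topological G & Group G}.

Section LieGroups.
Variables (R : realType) (G : preTopologicalGroupType) (EG : tvsType R).
Variable mG : charted_space G EG.

Definition lie_group : Prop :=
  [/\ frechet_manifold mG,
      smooth_map (prod_charted mG mG) mG (fun p : G * G => (p.1 * p.2)%g)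
    & smooth_map mG mG (fun g : G => g^-1%g)].

(* Smoothness of [exp] itself, which is often part of the definition, is not
   required. *)
Definition exponential_map (exp : EG -> G) : Prop :=
  forall xi, let gamma := fun t : R^o => exp (t *: xi) in
    [/\ smooth_map (model_space R^o) mG gamma,
        forall s t, gamma (s + t) = (gamma s * gamma t)%g
      & tmap (model_space R^o) mG gamma 0 1 = xi].

(* The Lie algebra of G is T_1 G, that is, EG. *)
Definition Ad (g : G) (eta : EG) : EG :=
  tmap mG mG (fun h : G => (g * h * g^-1)%g) 1%g eta.

(* ad is the derivative of Ad. This operation always satisfies the axioms of a
   Lie algebra, so that listing them restricts neither G nor br. *)
Definition lie_bracket_of (exp : EG -> G) (br : EG -> EG -> EG) : Prop :=
  lie_algebra_axioms br /\
  forall xi eta,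
    dderive (fun t : R^o => Ad (exp (t *: xi)) eta) 0 1 = br xi eta.

Section Actions.
Variables (M : topologicalType) (EM : tvsType R) (mM : charted_space M EM).
Variable act : G -> M -> M.

Definition smooth_action : Prop :=
  [/\ smooth_map (prod_charted mG mM) mM (fun p : G * M => act p.1 p.2),
      forall x, act 1%g x = x
    & forall g h x, act (g * h)%g x = act g (act h x)].

Definition symplectic_action (omega : M -> EM -> EM -> R) : Prop :=
  smooth_action /\
  forall g x v w,
    omega (act g x) (tmap mM mM (act g) x v) (tmap mM mM (act g) x w) =
    omega x v w.

Variable exp : EG -> G.

Definition inf_act (xi : EG) (x : M) : EM :=
  tmap (model_space R^o) mM (fun t : R^o => act (exp (t *: xi)) x) 0 1.

Definition stabilizer (x : M) : set EG := [set xi | inf_act xi x = 0].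

Variable j : M -> EM -> EM.

Definition tau (g : G) (x : M) (v : EM) : EM :=
  tmap mM mM (act g) (act g^-1%g x)
    (j (act g^-1%g x) (tmap mM mM (act g^-1%g) x v)) - j x v.

Definition tau' (xi : EG) (x : M) (v : EM) : EM :=
  dderive (fun t : R^o => tau (exp (t *: xi)) x v) 0 1.

Definition inf_actC (zeta : complexification EG) (x : M) : EM :=
  inf_act zeta.1 x + j x (inf_act zeta.2 x).

Definition stabilizerC (x : M) : set (complexification EG) :=
  [set zeta | inf_actC zeta x = 0].

End Actions.

Definition inner_pairing (kappa : EG -> EG -> R) : Prop :=
  [/\ forall xi, scalar (kappa xi),
      continuous (fun p : EG * EG => kappa p.1 p.2 : R^o),
      forall xi eta, kappa xi eta = kappa eta xi,
      forall xi, xi != 0 -> 0 < kappa xi xi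
    & forall xi, (forall eta, kappa xi eta = 0) -> xi = 0].

Section MomentumMaps.
Variables (M : topologicalType) (EM : tvsType R) (mM : charted_space M EM).
Variables (act : G -> M -> M) (exp : EG -> G) (br : EG -> EG -> EG).
Variables (omega : M -> EM -> EM -> R) (kappa : EG -> EG -> R).
Variable J : M -> EG.

Definition momentum_map : Prop :=
  smooth_map mM (model_space EG) J /\
  forall x v xi,
    omega x (inf_act mM act exp xi x) v +
    kappa (tmap mM (model_space EG) J x v) xi = 0.

Definition ad_equivariant : Prop :=
  forall xi x,
    tmap mM (model_space EG) J x (inf_act mM act exp xi x) = br xi (J x).

(* The non-equivariance cocycle Sigma, computed at the point x; its value does
   not depend on x when M is connected. *)
Definition noneq_cocycle (x : M) (xi eta : EG) : R :=
  kappa (J x) (br xi eta) +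
  omega x (inf_act mM act exp xi x) (inf_act mM act exp eta x).

End MomentumMaps.

End LieGroups.

(* Main.v *)
(** The condition that m is critical says that J(m).m = 0, so the flow of J(m)
    fixes m and acts on T_m M by symplectic maps T_t with
    T_t (xi.m) = (Ad_t xi).m; invariance of j_m under J(m) makes the generator
    of T_t commute with j_m. Hence ad J(m) preserves the stabilizer of m in g_C,
    on which i ad J(m) is symmetric for the Hermitian form kappa_C, and the
    spectral theorem in finite dimension gives the decomposition. If J is
    ad-equivariant and zeta = xi + i eta has eigenvalue l, then
    l kappa(eta, eta) = - omega(eta.m, j (eta.m)) <= 0, which kills the positive
    eigenvalues and identifies the kernel. If a reductive h contains (g_m)_C,
    the negative eigenspaces in h span an ideal n; splitting J(m) = y + z along
    n and a complementary ideal, [z, n] = 0, while i ad y strictly lowers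
    eigenvalues and yet equals i ad J(m) on n, so n = 0. *)

Require Import Defs.
From HB Require Import structures.
From mathcomp Require Import all_boot all_order all_algebra.
From mathcomp Require Import all_classical all_reals all_analysis.
From mathcomp Require Import complex.
From mathcomp Require Import ring.

Set Implicit Arguments.
Unset Strict Implicit.
Unset Printing Implicit Defensive.

Import Order.TTheory GRing.Theory Num.Theory.
Import numFieldTopology.Exports numFieldNormedType.Exports.

Local Open Scope classical_set_scope.
Local Open Scope ring_scope.

(** * Difference quotients of curves *)

(** The differential hypotheses are equations between values of [dderive], which is 0 where no limit
    exists. Thus the vanishing of [tau'] and the formula for [br] speak about derivatives only once
    the limits are shown to exist; hence a calculus of limits of difference quotients of curves at
    time 0 ([vel], [velocity]) with its own chain rule. A second obstacle is that [tmap] reads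
    values in preferred charts, which may jump from point to point. Near the identity of [G] and at
    the fixed point [m], everything is therefore rewritten in one pair of charts, where one more
    order of smoothness gives differentiability in [t]. In T_m M, identities are tested against
    [omega m], whose weak nondegeneracy separates vectors, and the momentum map equation turns such
    tests into statements about [kappa]. This also yields linearity of the infinitesimal action in
    xi, which is invisible in its definition through [exp]. Frechet manifolds offer no general
    uniqueness of integral curves, so the constancy of orbits comes from a mean value argument on
    convex sets. *)

Section MeanValue.
Variable R : realType.

(** Cousin's argument: the supremum of the [t] with [P 0 t] is reached from its left and, if it were
    below 1, could be passed on its right. The local hypothesis concerns only intervals having [s]
    as an endpoint, which is what a derivative at [s] controls. *)
Lemma cousin01 (P : R -> R -> Prop) :
  (forall a b c, a < b -> b < c -> P a b -> P b c -> P a c) ->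
  (forall s, 0 <= s <= 1 -> \forall r \near (0 : R)^',
     (0 < r -> P s (s + r)) /\ (r < 0 -> P (s + r) s)) ->
  P 0 1.
Proof.
move=> chain loc.
have {}loc s : 0 <= s <= 1 -> exists2 e, 0 < e &
    (forall b, s < b -> b < s + e -> P s b) /\
    (forall a, a < s -> s - e < a -> P a s).
  move=> /loc[e /= e0 He]; exists e => //; split=> [b sb bse|a as_ sea].
    have /= := He (b - s); rewrite sub0r normrN gtr0_norm ?subr_gt0//.
    rewrite ltrBlDl subr_eq0 gt_eqF// subrKC => /(_ bse isT)[+ _].
    exact.
  have /= := He (a - s); rewrite sub0r opprB gtr0_norm ?subr_gt0//.
  rewrite ltrBlDl -ltrBlDr subr_eq0 lt_eqF// subrKC => /(_ sea isT)[_].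
  by apply; rewrite subr_lt0.
pose S := [set t | [/\ 0 < t, t <= 1 & P 0 t]].
have S0 : S !=set0.
  have [|e e0 [He _]] := loc 0; first by rewrite lexx ler01.
  exists (Num.min (e / 2) 1); split; first by rewrite lt_min divr_gt0/=.
    by rewrite ge_min lexx orbT.
  apply: He; first by rewrite lt_min divr_gt0/=.
  by rewrite add0r gt_min ltr_pdivrMr// ltr_pMr// ltr1n.
have Sup : has_sup S by split => //; exists 1 => t [].
have [t0 St0] := S0; have t0gt : 0 < t0 by case: St0.
have s0 : 0 < sup S by apply: lt_le_trans t0gt _; apply: ub_le_sup => //; case: Sup.
have s1 : sup S <= 1 by apply: ge_sup => // t [].
have [|e e0 [Hr Hl]] := loc (sup S); first by rewrite ltW.
have Ps : P 0 (sup S).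
  have [t St tl] := sup_adherent e0 Sup; have [tg t1 Pt] := St.
  have : t <= sup S by apply: ub_le_sup => //; case: Sup.
  rewrite le_eqVlt => /predU1P[<-//|ts].
  exact: chain Pt (Hl _ ts tl).
move: s1; rewrite le_eqVlt => /predU1P[<-//|s1].
have [b [sb b1 be]] : exists b, [/\ sup S < b, b <= 1 & b < sup S + e].
  exists (Num.min (sup S + e / 2) 1); split.
  - by rewrite lt_min s1 ltrDl divr_gt0.
  - by rewrite ge_min lexx orbT.
  - by rewrite gt_min ltrD2l ltr_pdivrMr// ltr_pMr// ltr1n.
have Sb : S b.
  split=> //; first exact: lt_trans sb.
  by apply: chain Ps (Hr _ sb be).
by have := ub_le_sup (proj2 Sup) Sb; rewrite leNgt sb.
Qed.

Definition convex_subset (E : lmodType R) (C : set E) : Prop :=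
  forall x y (t : R), 0 <= t <= 1 -> C x -> C y -> C (t *: x + (1 - t) *: y).

(** The slope over [[a, c]] is a convex combination of the slopes over [[a, b]] and [[b, c]],
    weighted by length, so lying in [C] is a relation that [cousin01] can chain. *)
Lemma mean_value (E : lmodType R) (C : set E) (g : R -> E) :
  convex_subset C ->
  (forall s, 0 <= s <= 1 ->
     \forall r \near (0 : R)^', C (r^-1 *: (g (s + r) - g s))) ->
  C (g 1 - g 0).
Proof.
move=> cC dg; pose P a b := C ((b - a)^-1 *: (g b - g a)).
suff : P 0 1 by rewrite /P subr0 invr1 scale1r.
apply: cousin01 => [a b c ab bc Pab Pbc|s s01].
  have ca : 0 < c - a by rewrite subr_gt0 (lt_trans ab).
  have ba : 0 < b - a by rewrite subr_gt0.
  have cb : 0 < c - b by rewrite subr_gt0.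
  have t01 : 0 <= (b - a) / (c - a) <= 1.
    by rewrite ler_pdivrMr// mul1r lerD2r (ltW bc) divr_ge0 ?ltW.
  have := cC _ _ _ t01 Pab Pbc; rewrite !scalerA.
  have -> : 1 - (b - a) / (c - a) = (c - b) / (c - a).
    rewrite -[1](divff (lt0r_neq0 ca)) -mulrBl; congr (_ / _).
    by rewrite opprB addrA subrK.
  rewrite mulrAC divff ?lt0r_neq0// div1r mulrAC divff ?lt0r_neq0// div1r.
  rewrite -scalerDr [g b - _ + _]addrC addrA subrK; apply.
have := dg s s01; apply: filterS => r; rewrite /P addrAC subrr add0r => Cr.
split=> // _; rewrite opprD addrA subrr add0r invrN scaleNr -scalerN opprB.
exact: Cr.
Qed.

End MeanValue.

Section LinearMaps.
Variables (K : pzRingType) (U V : lmodType K) (T : U -> V).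
Hypothesis lT : linear T.

Let L : {linear U -> V} := HB.pack T (GRing.isLinear.Build K U V _ T lT).

Lemma linear_fun0 : T 0 = 0. Proof. exact: (linear0 L). Qed.
Lemma linear_funN x : T (- x) = - T x. Proof. exact: (linearN L). Qed.
Lemma linear_funD x y : T (x + y) = T x + T y. Proof. exact: (linearD L). Qed.
Lemma linear_funB x y : T (x - y) = T x - T y. Proof. exact: (linearB L). Qed.
Lemma linear_funZ a x : T (a *: x) = a *: T x. Proof. exact: (linearZZ L). Qed.

End LinearMaps.

Section Velocity.
Variable R : realType.
Implicit Types E F : tvsType R.

Lemma tvs_cvgD E T (F : set_system T) {FF : Filter F} (f g : T -> E) a b :
  f @ F --> a -> g @ F --> b -> (fun x => f x + g x) @ F --> a + b.
Proof.
by move=> fa gb; exact: (cvg_comp _ _ (cvg_pair fa gb) (@add_continuous E (a, b))).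
Qed.

Lemma tvs_cvgZ E T (F : set_system T) {FF : Filter F} (f : T -> R) (g : T -> E)
    (a : R) (b : E) :
  f @ F --> a -> g @ F --> b -> (fun x => f x *: g x) @ F --> a *: b.
Proof.
move=> fa gb.
exact: (cvg_comp _ _ (cvg_pair fa gb) (@scale_continuous R E (a, b))).
Qed.

Lemma cvg_mulr_dnbhs0 (r : R) :
  r != 0 -> (fun h => h * r) @ (0 : R)^' --> (0 : R)^'.
Proof.
move=> r0 N [d /= d0 dN]; exists (d / `|r|); first by rewrite /= divr_gt0 ?normr_gt0.
move=> h /=; rewrite sub0r normrN ltr_pdivlMr ?normr_gt0// -normrM => rd h0.
by apply: dN; rewrite /= ?sub0r ?normrN// mulf_neq0.
Qed.

(** The derivative at time 0 as a relation: unlike an equation for [dderive], it asserts that the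
    limit exists. *)
Definition vel E (c : R^o -> E) (l : E) : Prop :=
  (fun h : R => h^-1 *: (c h - c 0)) @ (0 : R)^' --> l.

Lemma vel_cst E (x : E) : vel (fun=> x) 0.
Proof.
rewrite /vel (_ : (fun _ => _) = fun=> 0); first exact: cvg_cst.
by apply/funext => h; rewrite subrr scaler0.
Qed.

Lemma vel_unique E (c : R^o -> E) l k :
  hausdorff_space E -> vel c l -> vel c k -> l = k.
Proof. by move=> hE cl ck; exact: cvg_unique cl ck. Qed.

Lemma eq_vel E (c d : R^o -> E) l : c =1 d -> vel c l -> vel d l.
Proof. by move=> /funext->. Qed.

Lemma near_vel E (c d : R^o -> E) l :
  (\forall t \near (0 : R), c t = d t) -> vel c l -> vel d l.
Proof.
move=> cd; apply: cvg_trans; apply: near_eq_cvg.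
have cd0 := nbhs_singleton cd; rewrite /= in cd0.
by apply: nbhs_dnbhs; apply: filterS cd => h /= ->; rewrite cd0.
Qed.

Lemma vel_continuous E (c : R^o -> E) l : vel c l -> {for 0, continuous c}.
Proof.
move=> cl; apply/(@continuous_withinNx R E c 0).
have -> : c 0 = c 0 + (0 : R) *: l by rewrite scale0r addr0.
apply: (@cvg_trans _ ((fun h => c 0 + h *: (h^-1 *: (c h - c 0))) @ (0 : R)^')).
  apply: near_eq_cvg; near=> h => /=.
  rewrite scalerA divff ?scale1r ?subrKC//.
  by near: h; exact: nbhs_dnbhs_neq.
apply: tvs_cvgD; first exact: cvg_cst.
by apply: tvs_cvgZ => //; apply: cvg_within_filter; exact: cvg_id.
Unshelve. all: by end_near. Qed.

Lemma vel_pair E F (c : R^o -> E) (d : R^o -> F) l k :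
  vel c l -> vel d k -> vel (fun t => (c t, d t)) (l, k).
Proof. by move=> cl dk; exact: cvg_pair cl dk. Qed.

Lemma vel_affine E (a v : E) : vel (fun h => a + h *: v) v.
Proof.
apply: (@cvg_trans _ ((fun=> v) @ (0 : R)^')); last exact: cvg_cst.
apply: near_eq_cvg; near=> h => /=.
rewrite scale0r addr0 [a + _]addrC addrK scalerA mulVf ?scale1r//.
by near: h; exact: nbhs_dnbhs_neq.
Unshelve. all: by end_near. Qed.

Lemma vel_scale E (r : R) (c : R^o -> E) l :
  vel c l -> vel (fun t => c (t * r)) (r *: l).
Proof.
have [->|r0] := eqVneq r 0 => cl.
  rewrite scale0r; apply: eq_vel (vel_cst (c 0)) => t; by rewrite mulr0.
rewrite /vel mul0r.
have rh := cvg_mulr_dnbhs0 r0.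
apply: (@cvg_trans _ ((fun h => r *: ((h * r)^-1 *: (c (h * r) - c 0))) @ (0 : R)^'));
  last exact: (tvs_cvgZ (cvg_cst r) (cvg_comp _ _ rh cl)).
apply: near_eq_cvg; near=> h => /=.
by rewrite invfM mulrC scalerA mulrA divff// mul1r.
Unshelve. all: by end_near. Qed.

(** The Leibniz rule. In the usual splitting the quotient of [c] is paired with the moving [d h],
    which is where joint continuity of [B] enters. *)
Lemma vel_bilin E F (B : E -> F -> R) (c : R^o -> E) (d : R^o -> F) l k :
  (forall x, scalar (B x)) -> (forall y, scalar (B^~ y)) ->
  continuous (fun p : E * F => B p.1 p.2 : R^o) ->
  vel c l -> vel d k ->
  vel (fun t => B (c t) (d t) : R^o) (B l (d 0) + B (c 0) k).
Proof.
move=> Bl Br Bc cl dk; rewrite /vel.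
rewrite (_ : (fun _ => _) = (fun h : R => B (h^-1 *: (c h - c 0)) (d h) +
                               B (c 0) (h^-1 *: (d h - d 0)) : R^o)); last first.
  apply/funext => h; rewrite (linear_funZ (Bl _)) (linear_funZ (Br _)).
  rewrite (linear_funB (Bl _)) (linear_funB (Br _)) -mulrDr.
  by rewrite addrA subrK.
have dc := vel_continuous dk.
apply: (@tvs_cvgD R^o).
  have d0 : d @ (0 : R)^' --> d 0 by apply: cvg_within_filter; exact: dc.
  exact: (cvg_comp _ _ (cvg_pair cl d0) (Bc (l, d 0))).
exact: (cvg_comp _ _ (cvg_pair (cvg_cst (c 0)) dk) (Bc (c 0, k))).
Qed.

Lemma vel_lin E F (T : E -> F) (c : R^o -> E) l :
  linear T -> continuous T -> vel c l -> vel (T \o c) (T l).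
Proof.
move=> lT cT cl; have := cvg_comp _ _ cl (cT l).
apply: cvg_trans; apply: near_eq_cvg; near=> h => /=.
by rewrite (linear_funZ lT) (linear_funB lT).
Unshelve. all: by end_near. Qed.

Lemma dderiveE E F (f : E -> F) a v l :
  hausdorff_space F -> vel (fun h => f (a + h *: v)) l -> dderive f a v = l.
Proof.
rewrite /vel scale0r addr0 => hF fl.
have H := @xgetPex _ (0 : F) [set l : F | dquot f a v @ (0 : R)^' --> l]
  (ex_intro _ l fl).
exact: (cvg_unique hF H fl).
Qed.

Lemma dderive0 E F (f : E -> F) a : hausdorff_space F -> dderive f a 0 = 0.
Proof.
move=> hF; apply: dderiveE => //.
rewrite (_ : (fun _ => _) = fun=> f a); first exact: vel_cst.
by apply/funext => h; rewrite scaler0 addr0.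
Qed.

Lemma Cn_vel n E F (U : set E) (f : E -> F) a v :
  Cn n.+1 U f -> U a -> vel (fun h => f (a + h *: v)) (dderive f a v).
Proof.
move=> [_ [/(_ a v) + _]] Ua => /(_ Ua) fl; rewrite /vel scale0r addr0.
exact: (@xgetPex _ (0 : F) [set l : F | dquot f a v @ (0 : R)^' --> l] fl).
Qed.

Lemma Cn1_dderive_continuous n E F (U : set E) (f : E -> F) a v :
  Cn n.+1 U f -> U a ->
  {for (a, v), continuous (fun p : E * E => dderive f p.1 p.2)}.
Proof. by move=> [_ [_]] + Ua; case: n => [|n] [H _]; exact: H. Qed.

Lemma nbhs_convex E (x : E) (N : set E) : nbhs x N ->
  exists C : set E, [/\ nbhs x C, C `<=` N & convex_subset C].
Proof.
have [B cB [oB fB]] := @locally_convex R E.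
move=> /fB[C /= [BC Cx] CN]; exists C; split => //.
  by apply: open_nbhs_nbhs; split => //; exact: oB.
move=> y z t t01 Cy Cz.
have /(_ y z) := cB C (mem_set BC).
move=> /(_ (Itv01 (proj1 (andP t01)) (proj2 (andP t01)))).
by rewrite !inE; exact.
Qed.

End Velocity.

Arguments vel_affine {R E} a v.
Arguments vel_scale {R E} r [c l] _.

Section ChainRule.
Variable R : realType.
Implicit Types E F : tvsType R.

(* The mean value theorem applied to s |-> h^-1 f (a + s (c h - a)) keeps the
   difference quotient of f o c inside any convex neighbourhood of the
   candidate derivative. *)
Lemma vel_comp n E F (U : set E) (f : E -> F) (c : R^o -> E) (l : E) :
  open U -> Cn n.+1 U f -> U (c 0) -> vel c l ->
  vel (f \o c) (dderive f (c 0) l).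
Proof.
move=> oU fC Uc cl N /nbhs_convex[C [Cn CN cC]].
pose w h := h^-1 *: (c h - c 0).
have fD := Cn1_dderive_continuous fC Uc (v := l).
have [[A B] /= [nA nB] AB] := fD _ (nbhs_interior Cn).
have nAU : nbhs (c 0) (A `&` U).
  by apply: filterI => //; exact: open_nbhs_nbhs.
(* This controls the whole segment from [c 0] to [c h]: its points are [c 0 + (s * h) *: w h], with
   [s * h] near 0 and [w h] near [l]. *)
have : (fun p : R * E => c 0 + p.1 *: p.2) @ ((0 : R), l) --> c 0.
  rewrite -{2}[c 0]addr0 -(scale0r l).
  apply: tvs_cvgD; first exact: cvg_cst.
  by apply: tvs_cvgZ; [exact: cvg_fst|exact: cvg_snd].
move=> /(_ _ nAU)[[S T] /= [nS nT] ST].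
have [e /= e0 eS] := nS.
have : \forall h \near (0 : R)^', [/\ h != 0, `|h| < e & (B `&` T) (w h)].
  near=> h; split.
  - by near: h; exact: nbhs_dnbhs_neq.
  - near: h; apply: nbhs_dnbhs; exists e => // x /=.
    by rewrite sub0r normrN.
  - by near: h; exact: (cl (B `&` T) (filterI nB nT)).
apply: filterS => h [h0 he [Bw Tw]] /=; apply: CN.
have hw : h *: w h = c h - c 0 by rewrite scalerA divff ?scale1r.
pose g s := h^-1 *: f (c 0 + (s * h) *: w h).
have -> : h^-1 *: (f (c h) - f (c 0)) = g 1 - g 0.
  by rewrite /g mul1r mul0r scale0r addr0 hw subrKC scalerBr.
apply: mean_value => // s /andP[s0 s1].
have Ss : S (s * h).
  apply: eS => /=; rewrite sub0r normrN normrM ger0_norm//.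
  by apply: le_lt_trans he; rewrite ler_piMl.
have [Ax Ux] := ST (s * h, w h) (conj Ss Tw).
have := Cn_vel (v := w h) fC Ux (AB (_, w h) (conj Ax Bw)).
have rh := cvg_mulr_dnbhs0 h0.
move=> /rh H; near=> r.
have : C ((r * h)^-1 *: (f (c 0 + (s * h) *: w h + (r * h) *: w h) -
                          f (c 0 + (s * h) *: w h + 0 *: w h))).
  by near: r; exact: H.
rewrite [0 *: _]scale0r addr0 -[c 0 + _ + _]addrA -scalerDl -mulrDl /g -scalerBr.
by rewrite invfM -[X in C X]scalerA.
Unshelve. all: by end_near. Qed.

(** By the mean value theorem [c 1 - c 0] lies in every convex neighbourhood of 0, and these
    separate points in a Hausdorff locally convex space. *)
Lemma cst_of_vel0 E (c : R -> E) : hausdorff_space E ->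
  (forall s, 0 <= s <= 1 -> vel (fun r => c (s + r)) 0) -> c 1 = c 0.
Proof.
move=> hE c0; apply/subr0_eq; apply: hE => A B nA nB.
have [C [Cn CB cC]] := nbhs_convex nB.
exists (c 1 - c 0); split; first exact: nbhs_singleton.
apply: CB; apply: (mean_value cC) => s s01; have := c0 s s01.
by rewrite /vel addr0 => /(_ C Cn).
Qed.

End ChainRule.

(** * Curves on manifolds *)

Section CurvesInCharts.
Variable R : realType.

Section OneChart.
Variables (M : topologicalType) (E : tvsType R) (c : chart M E).

Lemma img_bwd u : img c u -> dom c (bwd c u) /\ fwd c (bwd c u) = u.
Proof. by case=> x cx <-; rewrite fwdK. Qed.

Lemma open_fwd_image (O : set M) : open O -> open (fwd c @` (dom c `&` O)).
Proof.
move=> oO; rewrite openE => _ [x [cx Ox] <-].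
have iu : img c (fwd c x) by exists x.
have nO : nbhs (bwd c (fwd c x)) O.
  by rewrite fwdK//; exact: open_nbhs_nbhs.
have nI : nbhs (fwd c x) (img c).
  by apply: open_nbhs_nbhs; split => //; exact: open_img.
rewrite /interior/=; near=> u.
have iU : img c u by near: u.
have [cb fb] := img_bwd iU; exists (bwd c u) => //; split=> //.
by near: u; exact: (bwd_continuous iu).
Unshelve. all: by end_near. Qed.

(** Continuity of [gamma] is part of the notion because [fwd c] is arbitrary outside [dom c]: a
    derivative of [fwd c \o gamma] alone would not keep the curve in the chart. *)
Definition velocity (gamma : R^o -> M) (v : E) : Prop :=
  [/\ {for 0, continuous gamma}, dom c (gamma 0) & vel (fwd c \o gamma) v].

Lemma velocity_unique gamma v w : hausdorff_space E ->
  velocity gamma v -> velocity gamma w -> v = w.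
Proof. by move=> hE [_ _ gv] [_ _ gw]; exact: vel_unique gv gw. Qed.

Lemma velocity_cst x : dom c x -> velocity (fun=> x) 0.
Proof. by move=> cx; split => //; [exact: cvg_cst|exact: vel_cst]. Qed.

Lemma velocity_line x v : dom c x ->
  velocity (fun h => bwd c (fwd c x + h *: v)) v.
Proof.
move=> cx; have iu : img c (fwd c x) by exists x.
have lc := vel_continuous (vel_affine (fwd c x) v).
have l0 : fwd c x + (0 : R) *: v = fwd c x by rewrite scale0r addr0.
split; last first.
- apply: near_vel (vel_affine (fwd c x) v).
  have nI : nbhs (fwd c x + (0 : R) *: v) (img c).
    by rewrite l0; apply: open_nbhs_nbhs; split => //; exact: open_img.
  near=> h; rewrite /=; suff : img c (fwd c x + h *: v) by case/img_bwd.
  by near: h; exact: (lc _ nI).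
- by rewrite l0 fwdK.
- apply: continuous_comp; first exact: lc.
  by rewrite l0; exact: bwd_continuous.
Unshelve. all: by end_near. Qed.

Lemma near_dom gamma v : velocity gamma v -> \forall t \near (0 : R), dom c (gamma t).
Proof.
move=> [gc c0 _]; apply: gc; apply: open_nbhs_nbhs; split => //.
exact: open_dom.
Qed.

Lemma eq_velocity gamma delta v :
  gamma =1 delta -> velocity gamma v -> velocity delta v.
Proof. by move=> /funext->. Qed.

Lemma velocity_scale (r : R) gamma v :
  velocity gamma v -> velocity (fun t => gamma (t * r)) (r *: v).
Proof.
move=> [gc c0 gv]; split; last exact: (vel_scale r gv).
- apply: continuous_comp; first exact: mulrr_continuous.
  by rewrite mul0r.
- by rewrite mul0r.
Qed.

End OneChart.

Lemma velocity_model (E : tvsType R) (gamma : R^o -> E) v :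
  velocity (model_chart E) gamma v <-> vel gamma v.
Proof.
split=> [[_ _]//|gv]; split => //; exact: vel_continuous gv.
Qed.

Lemma velocity_prod (M N : topologicalType) (E F : tvsType R) (c : chart M E)
    (d : chart N F) gamma delta v w :
  velocity c gamma v -> velocity d delta w ->
  velocity (prod_chart c d) (fun t => (gamma t, delta t)) (v, w).
Proof.
move=> [gc c0 gv] [dc d0 dw]; split => //; last exact: vel_pair.
exact: cvg_pair.
Qed.

Lemma open_velocity_dom (M N : topologicalType) (E F : tvsType R)
    (mM : charted_space M E) (mN : charted_space N F) (f : M -> N) (c : chart M E)
    (d : chart N F) :
  smooth_map mM mN f -> open (fwd c @` (dom c `&` f @^-1` dom d)).
Proof.
move=> [fc _]; apply: open_fwd_image; apply: open_comp; last exact: open_dom.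
by move=> x _; exact: fc.
Qed.

Lemma velocity_comp (M N : topologicalType) (E F : tvsType R)
    (mM : charted_space M E) (mN : charted_space N F) (f : M -> N) c d gamma v :
  smooth_map mM mN f -> atlas mM c -> atlas mN d -> dom d (f (gamma 0)) ->
  velocity c gamma v ->
  velocity d (f \o gamma)
    (dderive (fwd d \o f \o bwd c) (fwd c (gamma 0)) v).
Proof.
move=> fS' ac ad df cg; have := near_dom cg; have [gc c0 gv] := cg => nd.
have [fc fS] := fS'.
split => //; first by apply: continuous_comp; [exact: gc|exact: fc].
pose U := fwd c @` (dom c `&` f @^-1` dom d).
have oU : open U := open_velocity_dom c d fS'.
have /= := vel_comp oU (fS c d ac ad 1%N) _ gv.
move=> H; apply: near_vel (H _); last by exists (gamma 0).
by apply: filterS nd => t /= ct; rewrite fwdK.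
Qed.

End CurvesInCharts.

Section TangentMaps.
Variable R : realType.

(** For [f] of class C^2 the map [(x, v) |-> dderive f x v] is C^1, so the chain rule applies to it.
    This is the source of differentiability in [t] for [Ad] and for the tangent maps of the
    action. *)
Lemma vel_dderive n (E F : tvsType R) (U : set E) (f : E -> F)
    (a w : R^o -> E) a' w' :
  open U -> Cn n.+2 U f -> U (a 0) -> vel a a' -> vel w w' ->
  exists l, vel (fun t => dderive f (a t) (w t)) l.
Proof.
move=> oU [_ [_ fC]] Ua va vw.
have oUT : open (U `*` [set: E]) by apply: open_setX => //; exact: openT.
by eexists; apply: (vel_comp oUT fC _ (vel_pair va vw)).
Qed.

Section OneMap.
Variables (M N : topologicalType) (E F : tvsType R).
Variables (mM : charted_space M E) (mN : charted_space N F).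
Hypothesis hF : hausdorff_space F.

Lemma velocity_tmap (f : M -> N) gamma x v :
  smooth_map mM mN f -> gamma 0 = x ->
  velocity (chart_at mM x) gamma v ->
  velocity (chart_at mN (f x)) (f \o gamma) (tmap mM mN f x v).
Proof.
move=> fS <- cg.
by apply: (velocity_comp fS) cg;
  [exact: chart_at_atlas|exact: chart_at_atlas|exact: mem_chart_at].
Qed.

Lemma tmapE (f : M -> N) x v l :
  velocity (chart_at mN (f x))
    (fun h => f (bwd (chart_at mM x) (fwd (chart_at mM x) x + h *: v))) l ->
  tmap mM mN f x v = l.
Proof. by move=> [_ _ fl]; exact: dderiveE. Qed.

Lemma tmap0 (f : M -> N) x : tmap mM mN f x 0 = 0.
Proof. exact: dderive0. Qed.

End OneMap.

Section Slices.
Variables (P M N : topologicalType) (D E F : tvsType R).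
Variables (mP : charted_space P D) (mM : charted_space M E).
Variables (mN : charted_space N F).
Hypothesis hF : hausdorff_space F.
Variable f : P * M -> N.
Hypothesis fS : smooth_map (prod_charted mP mM) mN f.

Lemma velocity_prod_comp b c d beta gamma u v :
  atlas mP b -> atlas mM c -> atlas mN d -> dom d (f (beta 0, gamma 0)) ->
  velocity b beta u -> velocity c gamma v ->
  velocity d (fun t => f (beta t, gamma t))
    (dderive (fwd d \o f \o bwd (prod_chart b c))
      (fwd b (beta 0), fwd c (gamma 0)) (u, v)).
Proof.
move=> ab ac ad df bu cv.
apply: (velocity_comp (gamma := fun t => (beta t, gamma t)) fS) => //.
- by exists b => //; exists c.
- exact: velocity_prod.
Qed.

Lemma velocity_slice_r p gamma x v :
  gamma 0 = x -> velocity (chart_at mM x) gamma v ->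
  velocity (chart_at mN (f (p, x))) (fun t => f (p, gamma t))
    (tmap mM mN (fun y => f (p, y)) x v).
Proof.
move=> gx cg.
have H delta : delta 0 = x -> velocity (chart_at mM x) delta v ->
  velocity (chart_at mN (f (p, x))) (fun t => f (p, delta t))
    (dderive (fwd (chart_at mN (f (p, x))) \o f \o
       bwd (prod_chart (chart_at mP p) (chart_at mM x)))
      (fwd (chart_at mP p) p, fwd (chart_at mM x) x) (0, v)).
  move=> dx cd; have cp := velocity_cst (mem_chart_at mP p).
  have := velocity_prod_comp (chart_at_atlas mP p) (chart_at_atlas mM x)
    (chart_at_atlas mN (f (p, x))) _ cp cd.
  by rewrite dx; apply; exact: mem_chart_at.
rewrite (tmapE hF (H _ _ _)); first exact: H.
  by rewrite scale0r addr0 fwdK//; exact: mem_chart_at.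
by apply: velocity_line; exact: mem_chart_at.
Qed.

Lemma velocity_slice_l y gamma x v :
  gamma 0 = x -> velocity (chart_at mP x) gamma v ->
  velocity (chart_at mN (f (x, y))) (fun t => f (gamma t, y))
    (tmap mP mN (fun x => f (x, y)) x v).
Proof.
move=> gx cg.
have H delta : delta 0 = x -> velocity (chart_at mP x) delta v ->
  velocity (chart_at mN (f (x, y))) (fun t => f (delta t, y))
    (dderive (fwd (chart_at mN (f (x, y))) \o f \o
       bwd (prod_chart (chart_at mP x) (chart_at mM y)))
      (fwd (chart_at mP x) x, fwd (chart_at mM y) y) (v, 0)).
  move=> dx cd; have cp := velocity_cst (mem_chart_at mM y).
  have := velocity_prod_comp (chart_at_atlas mP x) (chart_at_atlas mM y)
    (chart_at_atlas mN (f (x, y))) _ cd cp.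
  by rewrite dx; apply; exact: mem_chart_at.
rewrite (tmapE hF (H _ _ _)); first exact: H.
  by rewrite scale0r addr0 fwdK//; exact: mem_chart_at.
by apply: velocity_line; exact: mem_chart_at.
Qed.

End Slices.
End TangentMaps.

(** * Lie groups and their actions *)

Section LieGroupCurves.
Variables (R : realType) (G : preTopologicalGroupType) (EG : tvsType R).
Variables (mG : charted_space G EG) (exp : EG -> G) (br : EG -> EG -> EG).
Hypotheses (LG : lie_group mG) (expG : exponential_map mG exp).

Notation phi := (chart_at mG 1%g).

Lemma lie_group_hausdorff : hausdorff_space EG.
Proof. by case: LG => -[[]]. Qed.
Let hEG := lie_group_hausdorff.

Let mul_smooth : smooth_map (prod_charted mG mG) mG (fun p : G * G => (p.1 * p.2)%g).
Proof. by case: LG. Qed.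

Lemma expD xi (s t : R) : exp ((s + t) *: xi) = (exp (s *: xi) * exp (t *: xi))%g.
Proof. by have [_ ->] := expG xi. Qed.

Lemma exp0 : exp 0 = 1%g.
Proof.
have := expD 0 0 0; rewrite addr0 scaler0 => /(congr1 (fun x => (exp 0)^-1 * x)%g).
by rewrite /= mulVg mulKg.
Qed.

Lemma expN xi (t : R) : exp ((- t) *: xi) = (exp (t *: xi))^-1%g.
Proof.
have := expD xi t (- t); rewrite subrr scale0r exp0.
by move=> /(congr1 (fun x => (exp (t *: xi))^-1 * x)%g); rewrite /= mulg1 mulKg.
Qed.

Lemma velocity_exp xi : velocity phi (fun t : R^o => exp (t *: xi)) xi.
Proof.
have [gS _ gxi] := expG xi.
have := @velocity_tmap R _ _ _ _ (model_space R^o) mG _ id 0 1 gS erefl.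
rewrite gxi scale0r exp0; apply.
apply/(@velocity_model R R^o).
apply: eq_vel (vel_affine (0 : R^o) (1 : R^o)) => t.
by rewrite add0r -[RHS]mulr1.
Qed.

Lemma near_dom_exp xi :
  \forall t \near (0 : R), dom phi (exp (t *: xi)) /\ dom phi (exp (t *: xi))^-1%g.
Proof.
have e := velocity_exp xi; apply: filterI; first exact: near_dom e.
apply: filterS (near_dom (velocity_scale (-1) e)) => t /=.
by rewrite mulrN1 expN.
Qed.

(** Conjugation is a left translation followed by a right translation, two slices of the
    multiplication; the composite velocity [w] is the same for all curves with velocity [eta],
    including the line that defines [Ad]. *)
Lemma velocity_Ad g (eta : EG) gamma : gamma 0 = 1%g -> velocity phi gamma eta ->
  velocity phi (fun t => (g * gamma t * g^-1)%g) (Ad mG g eta).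
Proof.
move=> g0 cg.
pose w := tmap mG mG (fun h => (h * g^-1)%g) (g * 1)%g
  (tmap mG mG (fun h => (g * h)%g) 1%g eta).
have H delta : delta 0 = 1%g -> velocity phi delta eta ->
    velocity phi (fun t => (g * delta t * g^-1)%g) w.
  move=> d0 cd.
  have := velocity_slice_r hEG mul_smooth g d0 cd => /= c1.
  have e1 : (g * delta 0)%g = (g * 1)%g by rewrite d0.
  by have := velocity_slice_l hEG mul_smooth g^-1%g e1 c1; rewrite /= -/w mulg1 mulgV.
have -> : Ad mG g eta = w; last exact: H.
apply: tmapE => //; rewrite mulg1 mulgV; apply: H.
  by rewrite scale0r addr0 fwdK//; exact: mem_chart_at.
by apply: velocity_line; exact: mem_chart_at.
Qed.

Let mu := fwd phi \o (fun p : G * G => (p.1 * p.2)%g) \o bwd (prod_chart phi phi).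

(** Here [g] enters only through the arguments of derivatives of the fixed map [mu]. Factoring
    through [tmap] would involve the preferred chart at [g], which need not vary smoothly with
    [g]. *)
Lemma Ad_chartE g eta : dom phi g -> dom phi g^-1%g ->
  Ad mG g eta = dderive mu (fwd phi g, fwd phi g^-1%g)
    (dderive mu (fwd phi g, fwd phi 1%g) (0, eta), 0).
Proof.
move=> dg dgV.
have d1 : dom phi 1%g := mem_chart_at mG 1%g.
have aphi : atlas mG phi := chart_at_atlas mG 1%g.
pose line h := bwd phi (fwd phi 1%g + h *: eta).
have l0 : line 0 = 1%g by rewrite /line scale0r addr0 fwdK.
have cl : velocity phi line eta by exact: velocity_line.
have c1 := velocity_prod_comp mul_smooth aphi aphi aphi _ (velocity_cst dg) cl.
rewrite /= l0 mulg1 in c1; have {}c1 := c1 dg.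
have c2 := velocity_prod_comp mul_smooth aphi aphi aphi _ c1 (velocity_cst dgV).
rewrite /= l0 mulg1 mulgV in c2; have {}c2 := c2 d1.
exact: (velocity_unique hEG (velocity_Ad g l0 cl) c2).
Qed.

Hypothesis brE : lie_bracket_of mG exp br.

(** [brE] prescribes only the value of [dderive]. The limit exists because both nested derivatives
    in [Ad_chartE] can be differentiated along [exp (t *: xi)]. *)
Lemma vel_Ad xi eta : vel (fun t : R^o => Ad mG (exp (t *: xi)) eta) (br xi eta).
Proof.
suff [l hl] : exists l, vel (fun t : R^o => Ad mG (exp (t *: xi)) eta) l.
  have [_ /(_ xi eta) <-] := brE.
  rewrite (dderiveE (l := l))//; apply: eq_vel hl => t.
  by rewrite add0r (_ : t *: 1 = t :> R^o)//; exact: mulr1.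
have e := velocity_exp xi; have [_ e0 ve] := e.
have [_ _ veN] := velocity_scale (-1) e.
have aphi : atlas mG phi := chart_at_atlas mG 1%g.
have d1 : dom phi 1%g := mem_chart_at mG 1%g.
have [_ muS] := mul_smooth.
have ap : atlas (prod_charted mG mG) (prod_chart phi phi) by exists phi => //; exists phi.
(* Class C^2: one derivative of [mu] makes up [Ad], the second is taken in [t]. *)
have := muS _ _ ap aphi 2%N; rewrite -/mu.
set U := (X in Cn _ X _) => muU.
have oU : open U := open_velocity_dom _ _ mul_smooth.
have [|l1 v1] := vel_dderive oU muU _ (vel_pair ve (vel_cst (fwd phi 1%g)))
  (vel_cst ((0, eta) : EG * EG)).
  exists (1%g, 1%g) => /=; last by rewrite scale0r exp0.
  by rewrite /preimage/= mulg1.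
have [|l vl] := vel_dderive oU muU _ (vel_pair ve veN) (vel_pair v1 (vel_cst (0 : EG))).
  exists (1%g, 1%g) => /=; last by rewrite /= mul0r scale0r exp0.
  by rewrite /preimage/= mulg1.
exists l; apply: near_vel vl; near=> t; rewrite /= mulrN1 expN Ad_chartE//.
  by have [] : dom phi (exp (t *: xi)) /\ dom phi (exp (t *: xi))^-1%g
    by near: t; exact: near_dom_exp.
by have [] : dom phi (exp (t *: xi)) /\ dom phi (exp (t *: xi))^-1%g
  by near: t; exact: near_dom_exp.
Unshelve. all: by end_near. Qed.

End LieGroupCurves.

Section FixedCurves.
Variables (R : realType) (M : topologicalType) (E : tvsType R).
Variable mM : charted_space M E.
Hypothesis hE : hausdorff_space E.

(** Equality of endpoints is chained by [cousin01]. Locally the curve stays in one chart, where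
    [cst_of_vel0] applies to [u |-> gamma (s + u * r)]. *)
Lemma cst_of_velocity0 (gamma : R -> M) :
  (forall s d, atlas mM d -> dom d (gamma s) ->
     velocity d (fun r => gamma (s + r)) 0) ->
  gamma 1 = gamma 0.
Proof.
move=> g0; apply/esym.
apply: (@cousin01 _ (fun a b => gamma a = gamma b)) => [a b c _ _ -> //|s _].
pose d := chart_at mM (gamma s).
have ad : atlas mM d := chart_at_atlas mM (gamma s).
have ds : dom d (gamma s) := mem_chart_at mM (gamma s).
have [e /= e0 He] := near_dom (g0 s d ad ds).
suff H r : `|r| < e -> gamma (s + r) = gamma s.
  by apply: nbhs_dnbhs; exists e => // r /=; rewrite sub0r normrN => /H ->.
move=> re; have dr u : 0 <= u <= 1 -> dom d (gamma (s + u * r)).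
  move=> /andP[u0 u1]; apply: He => /=. rewrite sub0r normrN normrM ger0_norm//.
  by apply: le_lt_trans re; rewrite ler_piMl.
have /= : fwd d (gamma (s + 1 * r)) = fwd d (gamma (s + 0 * r)).
  apply: (@cst_of_vel0 _ _ (fun u => fwd d (gamma (s + u * r)))) => // u u01.
  have [_ _ gv] := velocity_scale r (g0 _ _ ad (dr u u01)).
  move: gv; rewrite scaler0; apply: eq_vel => t /=.
  by rewrite mulrDl addrA.
move=> /(congr1 (bwd d)); rewrite !fwdK ?mul1r ?mul0r ?addr0//.
by apply: He => /=; rewrite sub0r normrN.
Qed.

End FixedCurves.

Section ActionCurves.
Variables (R : realType) (G : preTopologicalGroupType) (EG : tvsType R).
Variables (mG : charted_space G EG) (exp : EG -> G).
Hypotheses (LG : lie_group mG) (expG : exponential_map mG exp).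
Variables (M : topologicalType) (E : tvsType R) (mM : charted_space M E).
Hypothesis hE : hausdorff_space E.
Variable act : G -> M -> M.
Hypothesis actS : smooth_action mG mM act.

Notation phi := (chart_at mG 1%g).
Notation inf_act := (inf_act mM act exp).
Notation T g := (tmap mM mM (act g)).

Let act_smooth : smooth_map (prod_charted mG mM) mM (fun p : G * M => act p.1 p.2).
Proof. by case: actS. Qed.

Let act1 x : act 1%g x = x. Proof. by case: actS. Qed.

Let actM g h x : act (g * h)%g x = act g (act h x). Proof. by case: actS. Qed.

Lemma velocity_act g gamma x v : gamma 0 = x ->
  velocity (chart_at mM x) gamma v ->
  velocity (chart_at mM (act g x)) (fun t => act g (gamma t)) (T g x v).
Proof. exact: (velocity_slice_r hE act_smooth g). Qed.

(** [inf_act] is defined by the curve [exp (t *: xi)]; allowing any curve with the same velocity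
    covers the conjugated curves of [velocity_Ad]. *)
Lemma velocity_orbit gamma xi x : gamma 0 = 1%g -> velocity phi gamma xi ->
  velocity (chart_at mM x) (fun t => act (gamma t) x) (inf_act xi x).
Proof.
move=> g0 cg; pose w := tmap mG mM (act^~ x) 1%g xi.
have H delta : delta 0 = 1%g -> velocity phi delta xi ->
    velocity (chart_at mM x) (fun t => act (delta t) x) w.
  move=> d0 cd.
  by have := velocity_slice_l hE act_smooth x d0 cd; rewrite /= -/w act1.
have -> : inf_act xi x = w; last exact: H.
apply: (@tmapE R R^o M R^o E (model_space R^o) mM hE) => /=.
rewrite scale0r (exp0 expG) act1.
have := H _ _ (velocity_exp expG xi); rewrite scale0r (exp0 expG) => /(_ erefl).
congr velocity; apply/funext => h; rewrite add0r; congr (act (exp (_ *: _)) x).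
by rewrite -[LHS]mulr1.
Qed.

(** The one-parameter group law transports the zero velocity at time 0 to every time, and a curve
    with zero velocity everywhere is constant. *)
Lemma inf_act0_fixed xi x (t : R) : inf_act xi x = 0 -> act (exp (t *: xi)) x = x.
Proof.
move=> xi0; pose c u := act (exp ((u * t) *: xi)) x.
have c0 : c 0 = x by rewrite /c mul0r scale0r (exp0 expG) act1.
suff : c 1 = c 0 by rewrite c0 /c mul1r.
apply: (cst_of_velocity0 (mM := mM)) => // s d ad ds.
have ve := velocity_orbit x _ (velocity_exp expG xi).
rewrite scale0r (exp0 expG) xi0 in ve.
have {}ve := velocity_scale t (ve erefl); rewrite scaler0 in ve.
set g := exp ((s * t) *: xi).
have dg : dom (chart_at mG g) g := mem_chart_at mG g.
(* Since [c (s + u) = act g (c u)] with [g] frozen, the action is differentiated in the direction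
   [(0, 0)]. *)
have := velocity_prod_comp act_smooth (chart_at_atlas mG g) (chart_at_atlas mM x)
  ad _ (velocity_cst dg) ve.
rewrite /= mul0r scale0r (exp0 expG) act1 dderive0// => /(_ ds).
congr velocity; apply/funext => u.
by rewrite /c mulrDl (expD expG) actM.
Qed.

Variable m : M.
Notation psi := (chart_at mM m).

Section Fixed.
Variable g : G.
Hypothesis gm : act g m = m.

Lemma fixedV : act g^-1%g m = m.
Proof. by rewrite -[in LHS]gm -actM mulVg act1. Qed.

Lemma velocity_fixed gamma v : gamma 0 = m -> velocity psi gamma v ->
  velocity psi (fun t => act g (gamma t)) (T g m v).
Proof. by move=> g0 cg; have := velocity_act g g0 cg; rewrite gm. Qed.

(** As [g^-1] fixes [m], g exp(t xi) m = (g exp(t xi) g^-1) m. *)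
Lemma T_inf_act xi : T g m (inf_act xi m) = inf_act (Ad mG g xi) m.
Proof.
have e0 : exp ((0 : R) *: xi) = 1%g by rewrite scale0r (exp0 expG).
have ve := velocity_exp expG xi.
have v1 : velocity psi (fun t : R^o => act (exp (t *: xi)) m) (inf_act xi m).
  exact: velocity_orbit.
have v2 := velocity_fixed _ v1; rewrite e0 act1 in v2.
have v3 := velocity_orbit m _ (velocity_Ad LG g e0 ve).
rewrite e0 mulg1 mulgV in v3.
apply: velocity_unique (v2 erefl) _ => //.
apply: eq_velocity (v3 erefl) => t.
by rewrite !actM fixedV.
Qed.

(** The analogue of [Ad_chartE]: because [g] fixes [m], the charts [phi] and [psi] serve for all [g]
    near the identity. *)
Lemma fixed_chartE v : dom phi g -> T g m v =
  dderive (fwd psi \o (fun p : G * M => act p.1 p.2) \o bwd (prod_chart phi psi))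
    (fwd phi g, fwd psi m) (0, v).
Proof.
move=> dg; pose line h := bwd psi (fwd psi m + h *: v).
have dm := mem_chart_at mM m.
have l0 : line 0 = m by rewrite /line scale0r addr0 fwdK.
have cl : velocity psi line v by exact: velocity_line.
have := velocity_prod_comp act_smooth (chart_at_atlas mG 1%g) (chart_at_atlas mM m)
  (chart_at_atlas mM m) _ (velocity_cst dg) cl.
rewrite /= l0 gm => /(_ dm); apply: velocity_unique => //.
exact: velocity_fixed.
Qed.

End Fixed.

Lemma TVK g v : act g m = m -> T g m (T g^-1%g m v) = v.
Proof.
move=> gm; pose line h := bwd psi (fwd psi m + h *: v).
have dm := mem_chart_at mM m.
have l0 : line 0 = m by rewrite /line scale0r addr0 fwdK.
have cl : velocity psi line v by exact: velocity_line.
have v1 := velocity_fixed (fixedV gm) l0 cl.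
have v2 := velocity_fixed gm (gamma := fun t => act g^-1%g (line t)) _ v1.
rewrite l0 (fixedV gm) in v2.
apply: velocity_unique (v2 erefl) _ => //.
by apply: eq_velocity cl => t; rewrite -actM mulgV act1.
Qed.

(** The vector is allowed to move so that conjugates such as [T t (j m (T (- t) v))] are covered.
    Only existence is obtained; the value is found later by pairing with [omega]. *)
Lemma vel_T xi (w : R^o -> E) w' : inf_act xi m = 0 -> vel w w' ->
  exists l, vel (fun t : R^o => T (exp (t *: xi)) m (w t)) l.
Proof.
move=> xi0 vw; have e := velocity_exp expG xi; have [_ e0 ve] := e.
have [_ aS] := act_smooth; have dm := mem_chart_at mM m.
have ap : atlas (prod_charted mG mM) (prod_chart phi psi).
  by exists phi; [exact: chart_at_atlas|exists psi => //; exact: chart_at_atlas].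
have := aS _ _ ap (chart_at_atlas mM m) 2%N.
set U := (X in Cn _ X _) => aU.
have oU : open U := open_velocity_dom _ _ act_smooth.
have [|l vl] := vel_dderive oU aU _ (vel_pair ve (vel_cst (fwd psi m)))
  (vel_pair (vel_cst (0 : EG)) vw).
  exists (1%g, m) => /=; last by rewrite scale0r (exp0 expG).
  split; first by split => //; exact: mem_chart_at.
  by rewrite /preimage/= act1.
exists l; apply: near_vel vl; near=> t; rewrite /= fixed_chartE//.
  exact: inf_act0_fixed.
by near: t; exact: near_dom e.
Unshelve. all: by end_near. Qed.

End ActionCurves.

(** * The linearized action at a critical point *)

Section TensorsAtAPoint.
Variables (R : realType) (M : topologicalType) (E : tvsType R).
Variables (mM : charted_space M E) (m : M).
Hypothesis hE : hausdorff_space E.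
Notation psi := (chart_at mM m).

Let dm : dom psi m := mem_chart_at mM m.

Let vel_line v : vel (fun h : R^o => fwd psi (bwd psi (fwd psi m + h *: v))) v.
Proof. by have [_ _] := velocity_line v dm. Qed.

(** At [m] the preferred chart is the one through which T_m M is identified with [E]. Hence
    chartwise smoothness of the tensors gives continuity of [omega m] and [j m] by restriction to
    the base point. *)
Lemma to_tangentE v : to_tangent mM psi (fwd psi m) v = v.
Proof. by rewrite /to_tangent /tmap/= fwdK//; apply: dderiveE => //; exact: vel_line. Qed.

Lemma of_tangentE v : of_tangent mM psi m v = v.
Proof. by apply: dderiveE => //; exact: vel_line. Qed.

Lemma symplectic_form_continuous omega : symplectic_form mM omega ->
  continuous (fun p : E * E => omega m p.1 p.2 : R^o).
Proof.
move=> [_ _ oS _ _] p.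
have [+ _] := oS _ (chart_at_atlas mM m) 0%N.
move=> /(_ (fwd psi m, p)) oC.
have {}oC := oC (conj (ex_intro2 _ _ m dm erefl) I).
have pC : {for p, continuous (fun p => (fwd psi m, p))}.
  exact: cvg_pair (cvg_cst _) (@cvg_id _ (nbhs p)).
have -> : (fun p : E * E => omega m p.1 p.2 : R^o) =
    (fun p => local_form mM omega psi p.1 p.2.1 p.2.2) \o (fun p => (fwd psi m, p)).
  by apply/funext => q; rewrite /local_form/= !to_tangentE fwdK.
exact: continuous_comp pC oC.
Qed.

Lemma almost_complex_continuous j : almost_complex_structure mM j ->
  continuous (j m).
Proof.
move=> [_ jS _] v.
have [+ _] := jS _ (chart_at_atlas mM m) 0%N.
move=> /(_ (fwd psi m, v)) jC.
have {}jC := jC (conj (ex_intro2 _ _ m dm erefl) I).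
have pC : {for v, continuous (fun v => (fwd psi m, v))}.
  exact: cvg_pair (cvg_cst _) (@cvg_id _ (nbhs v)).
have -> : j m = (fun p : E * E => of_tangent mM psi (bwd psi p.1)
    (j (bwd psi p.1) (to_tangent mM psi p.1 p.2))) \o (fun v => (fwd psi m, v)).
  by apply/funext => q; rewrite /= to_tangentE fwdK// of_tangentE.
exact: continuous_comp pC jC.
Qed.

End TensorsAtAPoint.

Section CriticalPoint.
Variables (R : realType)
  (M : topologicalType) (EM : tvsType R) (mM : charted_space M EM)
  (omega : M -> EM -> EM -> R)
  (G : preTopologicalGroupType) (EG : tvsType R) (mG : charted_space G EG)
  (exp : EG -> G) (br : EG -> EG -> EG)
  (act : G -> M -> M) (j : M -> EM -> EM)
  (kappa : EG -> EG -> R) (J : M -> EG) (m : M).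
Hypotheses (MF : frechet_manifold mM) (omegaP : symplectic_form mM omega)
  (LG : lie_group mG) (expG : exponential_map mG exp)
  (brE : lie_bracket_of mG exp br)
  (actP : symplectic_action mG mM act omega)
  (jP : almost_complex_structure mM j)
  (kappaP : inner_pairing kappa)
  (JP : momentum_map mM act exp omega kappa J).

Notation D xi := (inf_act mM act exp xi m).
Notation TJ := (tmap mM (model_space EG) J m).
Notation om := (omega m).

Let hRo : hausdorff_space (R^o : tvsType R).
Proof. exact: (@norm_hausdorff _ R^o). Qed.

Lemma frechet_manifold_hausdorff : hausdorff_space EM.
Proof. by case: MF => -[]. Qed.
Let hEM := frechet_manifold_hausdorff.

Lemma omega_linear_r v : scalar (om v). Proof. by case: omegaP. Qed.

Lemma omega_anti v w : om v w = - om w v. Proof. by case: omegaP. Qed.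

Lemma omega_linear_l w : scalar (om^~ w).
Proof.
by move=> a x y; rewrite /= omega_anti omega_linear_r opprD -mulrN -!omega_anti.
Qed.

Lemma omega_inj v w : (forall u, om v u = om w u) -> v = w.
Proof.
have [_ _ _ _ nd] := omegaP; move=> vw; apply/subr0_eq/(nd m) => u.
by rewrite (linear_funB (omega_linear_l u)) vw subrr.
Qed.

Lemma kappa_linear_r x : scalar (kappa x). Proof. by case: kappaP. Qed.

Lemma kappaC x y : kappa x y = kappa y x. Proof. by case: kappaP. Qed.

Lemma kappa_linear_l y : scalar (kappa^~ y).
Proof. by move=> a u v; rewrite /= kappaC kappa_linear_r !(kappaC y). Qed.

Lemma momentumE xi v : om (D xi) v = - kappa (TJ v) xi.
Proof. by have [_ H] := JP; apply/eqP; rewrite -addr_eq0 H. Qed.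

(** The momentum map equation expresses [om (D xi) u] through [kappa], linearly in [xi], and [omega]
    is injective. *)
Lemma inf_act_linear : linear (fun xi => D xi).
Proof.
move=> a x y; apply: omega_inj => u.
by rewrite omega_linear_l !momentumE kappa_linear_r opprD mulrN.
Qed.

Section Critical.
Hypotheses (crit : critical_point mM (fun x => kappa (J x) (J x)) m)
  (tauJ : forall v, tau' mM act exp j (J m) m v = 0).

(** The derivative of the squared norm in the direction v is 2 kappa(TJ v, J(m)) = - 2 omega(J(m).m,
    v). *)
Lemma critical_stabilizer : D (J m) = 0.
Proof.
apply: omega_inj => v; rewrite (linear_fun0 (omega_linear_l v)) momentumE.
have [JS _] := JP; have dm := mem_chart_at mM m.
pose line h := bwd (chart_at mM m) (fwd (chart_at mM m) m + h *: v).
have l0 : line 0 = m by rewrite /line scale0r addr0 fwdK.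
have /velocity_model vJ := velocity_tmap JS l0 (velocity_line v dm).
have [_ kc _ _ _] := kappaP.
have := vel_bilin kappa_linear_r kappa_linear_l kc vJ vJ.
rewrite /= l0 [kappa (J m) _]kappaC => vk.
have := crit v; rewrite /tmap (dderiveE hRo vk).
by move/eqP; rewrite -mulr2n mulrn_eq0/= => /eqP->; rewrite oppr0.
Qed.

Lemma exp_fixes t : act (exp (t *: J m)) m = m.
Proof.
have [aS _] := actP.
exact: (inf_act0_fixed expG hEM aS t critical_stabilizer).
Qed.

Notation T t := (tmap mM mM (act (exp (t *: J m))) m).

Let omC := symplectic_form_continuous (m := m) hEM omegaP.

Let omV (a b : R^o -> EM) a' b' : vel a a' -> vel b b' ->
  vel (fun t => om (a t) (b t) : R^o) (om a' (b 0) + om (a 0) b').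
Proof. exact: (vel_bilin omega_linear_r omega_linear_l omC). Qed.

Let T_omega t v w : om (T t v) (T t w) = om v w.
Proof.
have [_ /(_ (exp (t *: J m)) m v w)] := actP.
by rewrite exp_fixes.
Qed.

Let T0 v : T 0 v = v.
Proof.
have [[_ act1 _] _] := actP; have dm := mem_chart_at mM m.
rewrite scale0r (exp0 expG) (_ : act 1%g = id); last exact/funext.
by apply: tmapE => //; exact: velocity_line.
Qed.

Let TNK t v : T t (T (- t) v) = v.
Proof.
have [aS _] := actP.
by rewrite (expN expG) (TVK hEM aS)// exp_fixes.
Qed.

Let tauE t v :
  tau mM act j (exp (t *: J m)) m v = T t (j m (T (- t) v)) - j m v.
Proof.
have [aS _] := actP.
by rewrite /tau (fixedV aS (exp_fixes t)) -(expN expG).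
Qed.

(** Two uses of [vel_T], with the continuous linear map [j m] between them, show that a limit
    exists; only then does [tauJ] identify it as 0. *)
Let vel_tau v : vel (fun t : R^o => T t (j m (T (- t) v))) 0.
Proof.
have [aS _] := actP; have [jl _ _] := jP.
have vT w w' : vel w w' -> exists l, vel (fun t : R^o => T t (w t)) l.
  by move=> vw; exact: (vel_T expG hEM aS critical_stabilizer vw).
have [A vA] := vT _ _ (vel_cst v).
have vj := vel_lin (jl m) (almost_complex_continuous hEM jP) (vel_scale (-1) vA).
have [l vl] := vT _ _ vj.
have {}vl : vel (fun t : R^o => T t (j m (T (- t) v))) l.
  by apply: eq_vel vl => t; rewrite /= mulrN1.
suff <- : l = 0 by [].
rewrite -(tauJ v); apply/esym/dderiveE => //.
have vl0 : vel (fun t : R^o => T t (j m (T (- t) v)) - j m v) l.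
  rewrite /vel (_ : (fun _ => _) = fun h : R => h^-1 *:
    (T h (j m (T (- h) v)) - T 0 (j m (T (- 0) v)))); first exact: vl.
  by apply/funext => t; rewrite opprB addrA subrK.
apply: eq_vel vl0 => t /=.
by rewrite add0r (_ : t *: 1 = t :> R^o) ?tauE//; exact: mulr1.
Qed.

Let vel_T_ex v : exists l, vel (fun t : R^o => T t v) l.
Proof.
have [aS _] := actP.
exact: (vel_T expG hEM aS critical_stabilizer (vel_cst v)).
Qed.

(** With no Leibniz formula for [T t (w t)] at hand, the conjugate is paired with a vector [w] and
    the outer [T t] is moved across [omega], leaving an ordinary bilinear derivative. *)
Lemma j_commutes v l l' : vel (fun t : R^o => T t v) l ->
  vel (fun t : R^o => T t (j m v)) l' -> l' = j m l.
Proof.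
move=> vl vl'; apply: omega_inj => w.
have [b vb] := vel_T_ex w.
have [jl _ _] := jP.
(* The generator of a symplectic flow is skew: [om (T t a) (T t w)] is constant in [t]. *)
have anti a a' : vel (fun t : R^o => T t a) a' -> om a' w = - om a b.
  move=> va; have := omV va vb; rewrite !T0.
  rewrite (_ : (fun _ => _) = fun=> om a w); last by apply/funext => t; rewrite T_omega.
  move=> /(vel_unique hRo (vel_cst (om a w : R^o))) /eqP.
  by rewrite eq_sym addr_eq0 => /eqP.
have vj := vel_lin (jl m) (almost_complex_continuous hEM jP) (vel_scale (-1) vl).
have v1 := omV vj (vel_scale (-1) vb).
have v2 := omV (vel_tau v) (vel_cst w).
have v3 : vel (fun t : R^o => om (T t (j m (T (- t) v))) w : R^o)
    (om (j m (-1 *: l)) w + om (j m v) (-1 *: b)).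
  rewrite /= mul0r !T0 in v1; apply: eq_vel v1 => t /=.
  by rewrite mulrN1 -[in RHS](TNK t w) T_omega.
have := vel_unique hRo v3 v2.
rewrite (linear_funZ (jl m)) (linear_fun0 (omega_linear_l w)).
rewrite (linear_fun0 (omega_linear_r _)) (linear_funZ (omega_linear_l w)).
rewrite (linear_funZ (omega_linear_r _)) !scaleN1r addr0 => /eqP.
by rewrite addr_eq0 opprK => /eqP H; rewrite (anti _ _ vl') -H opprK.
Qed.

(** Since [T t (D xi) = D (Ad_t xi)], the pairing with [w] is [kappa (TJ w) (Ad_t xi)]. The
    derivative thus passes through the continuous form [kappa] rather than through [D]. *)
Lemma vel_T_inf_act xi l :
  vel (fun t : R^o => T t (D xi)) l -> l = D (br (J m) xi).
Proof.
move=> vl; apply: omega_inj => w; rewrite omega_anti [RHS]omega_anti; congr (- _).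
have [aS _] := actP; have [_ kc _ _ _] := kappaP.
have := omV (vel_cst w) vl; rewrite (linear_fun0 (omega_linear_l _)) add0r => v1.
have vA : vel (fun t : R^o => Ad mG (exp (t *: J m)) xi) (br (J m) xi).
  exact: vel_Ad.
have := vel_bilin kappa_linear_r kappa_linear_l kc (vel_cst (TJ w)) vA.
rewrite (linear_fun0 (kappa_linear_l _)) add0r => v2.
rewrite [RHS]omega_anti momentumE opprK.
apply: (vel_unique hRo v1); apply: eq_vel v2 => t.
by rewrite (T_inf_act LG expG hEM aS (exp_fixes t)) omega_anti momentumE opprK.
Qed.

(** Membership reads [D xi = j m (D (- eta))]; the generator of [T t] is applied to both sides. *)
Lemma stabilizerC_ad xi eta : D xi + j m (D eta) = 0 ->
  D (br (J m) xi) + j m (D (br (J m) eta)) = 0.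
Proof.
have [jl _ _] := jP; have [[brl _ _ _] _] := brE.
move=> /eqP; rewrite addr_eq0 -(linear_funN (jl m)).
rewrite -(linear_funN inf_act_linear) => /eqP xe.
have [a va] := vel_T_ex (D xi); have [b vb] := vel_T_ex (D (- eta)).
have vj := va; rewrite xe in vj; have := j_commutes vb vj.
rewrite (vel_T_inf_act va) (vel_T_inf_act vb) => ->.
rewrite (linear_funN (brl _)) (linear_funN inf_act_linear).
by rewrite (linear_funN (jl m)) addNr.
Qed.

End Critical.
End CriticalPoint.

(** * Symmetric operators on finite-dimensional subspaces *)

Section Subspaces.
Variables (K : fieldType) (V : lmodType K).
Implicit Types (A : set V) (b : seq V).

Section Closure.
Variable A : set V.
Hypothesis sA : Defs.subspace A.

Lemma subspaceD x y : A x -> A y -> A (x + y).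
Proof. by move=> Ax Ay; have [_ H] := sA; have := H 1 x y Ax Ay; rewrite scale1r. Qed.

Lemma subspaceZ a x : A x -> A (a *: x).
Proof.
by move=> Ax; have [A0 H] := sA; have := H a x 0 Ax A0; rewrite addr0.
Qed.

Lemma subspaceN x : A x -> A (- x).
Proof. by rewrite -scaleN1r; exact: subspaceZ. Qed.

Lemma subspaceB x y : A x -> A y -> A (x - y).
Proof. by move=> Ax Ay; apply: subspaceD => //; exact: subspaceN. Qed.

Lemma subspace_sum (I : eqType) (s : seq I) (P : pred I) (v : I -> V) :
  (forall i, i \in s -> P i -> A (v i)) -> A (\sum_(i <- s | P i) v i).
Proof.
move=> Av; rewrite big_seq_cond; apply: big_ind => [||i /andP[]].
- by case: sA.
- exact: subspaceD.
- exact: Av.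
Qed.

Lemma lin_span_sub S : S `<=` A -> lin_span S `<=` A.
Proof.
move=> SA _ [s [sS ->]]; apply: subspace_sum => p ps _.
by apply/subspaceZ/SA/sS.
Qed.

End Closure.

Lemma lin_span_seqP b v :
  lin_span [set` b] v -> exists a : 'I_(size b) -> K, v = \sum_i a i *: b`_i.
Proof.
move=> [s [sb ->]]; elim: s sb => [|p s IH] sb.
  by exists (fun=> 0); rewrite big_nil big1// => i _; rewrite scale0r.
have [|a ea] := IH; first by move=> q qs; apply: sb; rewrite inE qs orbT.
have pb : p.2 \in b by apply: sb; rewrite inE eqxx.
(* [b] may have repetitions; the coefficient is charged to the first occurrence. *)
have ib : (index p.2 b < size b)%N by rewrite index_mem.
exists (fun i => a i + (if i == Ordinal ib then p.1 else 0)).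
rewrite big_cons ea addrC; under [RHS]eq_bigr do rewrite scalerDl.
rewrite big_split/= [X in _ = _ + X](bigD1 (Ordinal ib)) //= eqxx.
congr (_ + _); rewrite nth_index// big1 ?addr0// => i /negPf ->.
by rewrite scale0r.
Qed.

(** The coefficient matrix has one more row than columns, so its left kernel is nonzero. *)
Lemma lin_span_dependent b (v : 'I_(size b).+1 -> V) :
  (forall i, lin_span [set` b] (v i)) ->
  exists2 u : 'rV[K]_(size b).+1, u != 0 & \sum_i u 0 i *: v i = 0.
Proof.
move=> vb; have /choice[a va] := fun i => lin_span_seqP (vb i).
pose A := \matrix_(i, j) a i j.
have : kermx A != 0.
  by rewrite -mxrank_eq0 mxrank_ker subn_eq0 -ltnNge ltnS rank_leq_col.
move=> /rowV0Pn[u /sub_kermxP uA u0]; exists u => //.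
under eq_bigr do rewrite va scaler_sumr.
rewrite exchange_big big1//= => j _.
under eq_bigr do rewrite scalerA.
rewrite -scaler_suml; have /matrixP/(_ 0 j) := uA.
rewrite !mxE => uAj; rewrite (_ : \sum_i _ = 0) ?scale0r// -[RHS]uAj.
by apply: eq_bigr => i _; rewrite !mxE.
Qed.

Lemma finite_dimS A B : A `<=` B -> finite_dim B -> finite_dim A.
Proof. by move=> AB [b Bb]; exists b; exact: subset_trans Bb. Qed.

End Subspaces.

Section PolynomialsInAnOperator.
Variables (K : fieldType) (V : lmodType K) (T : V -> V).
Hypothesis lT : linear T.

(** This is p(T) w, for a [T] given as a bare function. *)
Definition poly_op (p : {poly K}) (w : V) : V := \sum_(i < size p) p`_i *: iter i T w.

Lemma poly_opE n (p : {poly K}) w : (size p <= n)%N ->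
  poly_op p w = \sum_(i < n) p`_i *: iter i T w.
Proof.
move=> pn; rewrite /poly_op (big_ord_widen n (fun i => p`_i *: iter i T w) pn).
rewrite big_mkcond; apply: eq_bigr => i _; case: ltnP => // pi.
by rewrite nth_default// scale0r.
Qed.

Lemma poly_opZ c p w : poly_op (c *: p) w = c *: poly_op p w.
Proof.
rewrite (@poly_opE (size p)) ?size_scale_leq// /poly_op scaler_sumr.
by apply: eq_bigr => i _; rewrite coefZ scalerA.
Qed.

Lemma poly_opXsubC a p w :
  poly_op (('X - a%:P) * p) w = poly_op p (T w - a *: w).
Proof.
have sz : (size (('X - a%:P) * p)%R <= (size p).+1)%N.
  by rewrite (leq_trans (size_polyMleq _ _))// size_XsubC.
have it i : iter i T (T w - a *: w) = iter i.+1 T w - a *: iter i T w.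
  elim: i => //= i ->; by rewrite (linear_funB lT) (linear_funZ lT).
rewrite (poly_opE w sz) (poly_opE _ (leqnn _)).
under [RHS]eq_bigr do rewrite it scalerBr.
rewrite sumrB mulrBl.
under eq_bigr do rewrite coefB coefCM coefXM scalerBl.
rewrite sumrB big_ord_recl/= scale0r add0r; congr (_ - _).
rewrite big_ord_recr/= nth_default// mulr0 scale0r addr0.
by apply: eq_bigr => i _; rewrite scalerA mulrC.
Qed.

Lemma poly_op_prod (s : seq K) w :
  poly_op (\prod_(a <- s) ('X - a%:P)) w = foldl (fun u a => T u - a *: u) w s.
Proof.
elim: s w => [|a s IH] w; last by rewrite big_cons poly_opXsubC IH.
by rewrite big_nil /poly_op size_poly1 big_ord1 coef1 scale1r.
Qed.

End PolynomialsInAnOperator.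

(** The iterates of [T] on [w] are linearly dependent, which gives a nonzero polynomial p with p(T)
    w = 0; over a closed field p splits into the factors listed in [s]. *)
Lemma annihilating_product (K : closedFieldType) (V : lmodType K) (T : V -> V)
    (W : set V) w :
  linear T -> (forall x, W x -> W (T x)) -> finite_dim W -> W w ->
  exists s : seq K, foldl (fun u a => T u - a *: u) w s = 0.
Proof.
move=> lT TW [b Wb] Ww.
have Wi i : W (iter i T w) by elim: i => //= i; exact: TW.
have [u u0 uw] := lin_span_dependent (fun i : 'I_(size b).+1 => Wb _ (Wi i)).
pose p := \poly_(i < (size b).+1) u 0 (inord i).
have pE (i : 'I_(size b).+1) : p`_i = u 0 i by rewrite coef_poly ltn_ord inord_val.
have p0 : p != 0.
  apply: contra_neq u0 => p0; apply/rowP => i.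
  by rewrite -pE p0 coef0 mxE.
have [s ps] := closed_field_poly_normal p; exists s.
have : poly_op T p w = 0.
  rewrite (@poly_opE _ _ T (size b).+1) ?size_poly// -[RHS]uw.
  by apply: eq_bigr => i _; rewrite pE.
rewrite -poly_op_prod//.
have lc0 : lead_coef p != 0 by rewrite lead_coef_eq0.
by rewrite ps poly_opZ => /eqP; rewrite scaler_eq0 (negPf lc0) => /eqP.
Qed.

(** * Hermitian forms and the spectral theorem *)

Section HermitianFormDef.
Variables (R : realType) (V : lmodType R[i]) (H : V -> V -> R[i]).

(** The axioms are relative to [W] because the invariant form of a compact subalgebra is constrained
    only on that subalgebra. *)
Definition hermitian_on (W : set V) : Prop :=
  [/\ forall a x y z, W x -> W y -> W z -> H (a *: x + y) z = a * H x z + H y z,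
      forall x y, W x -> W y -> H x y = conjc (H y x)
    & forall x, W x -> x != 0 -> 0 < H x x].

Lemma hermitian_onS (W W' : set V) : W' `<=` W -> hermitian_on W -> hermitian_on W'.
Proof.
move=> WW [Hl Hc Hp]; split=> [c x y z Wx Wy Wz|x y Wx Wy|x Wx].
- by apply: Hl; exact: WW.
- by apply: Hc; exact: WW.
- by apply: Hp; exact: WW.
Qed.

End HermitianFormDef.

Section HermitianForms.
Variables (R : realType) (V : lmodType R[i]) (W : set V) (H : V -> V -> R[i]).
Local Notation C := R[i].

Hypotheses (sW : Defs.subspace W) (HP : hermitian_on H W).

Let W0 : W 0. Proof. by case: sW. Qed.

Lemma hermC x y : W x -> W y -> H x y = conjc (H y x).
Proof. by case: HP => _ + _; exact. Qed.

Lemma herm0l z : W z -> H 0 z = 0.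
Proof.
case: HP => Hl _ _ Wz; have := Hl (-1) 0 0 z W0 W0 Wz.
by rewrite scaler0 addr0 mulN1r addNr.
Qed.

Lemma hermDl x y z : W x -> W y -> W z -> H (x + y) z = H x z + H y z.
Proof.
case: HP => Hl _ _ Wx Wy Wz; have := Hl 1 x y z Wx Wy Wz.
by rewrite scale1r mul1r.
Qed.

Lemma hermZl a x z : W x -> W z -> H (a *: x) z = a * H x z.
Proof.
case: HP => Hl _ _ Wx Wz; have := Hl a x 0 z Wx W0 Wz.
by rewrite addr0 herm0l// addr0.
Qed.

Lemma herm_suml (I : eqType) (s : seq I) (v : I -> V) z :
  (forall i, i \in s -> W (v i)) -> W z ->
  H (\sum_(i <- s) v i) z = \sum_(i <- s) H (v i) z.
Proof.
move=> Wv Wz; elim: s Wv => [|i s IH] Wv; first by rewrite !big_nil herm0l.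
have Ws k : k \in s -> W (v k) by move=> ks; apply: Wv; rewrite inE ks orbT.
rewrite !big_cons hermDl ?IH//; first by apply: Wv; rewrite inE eqxx.
by apply: subspace_sum => // k ks _; exact: Ws.
Qed.

Lemma hermZr a x z : W x -> W z -> H x (a *: z) = conjc a * H x z.
Proof.
move=> Wx Wz; have Waz := subspaceZ sW a Wz.
by rewrite hermC// hermZl// rmorphM [in RHS]hermC.
Qed.

Lemma herm_eq0 x : W x -> H x x = 0 -> x = 0.
Proof.
move=> Wx Hx; apply: contra_eq Hx => x0.
by rewrite gt_eqF//; case: HP => _ _; exact.
Qed.

Definition orthogonal_family n (e : nat -> V) (B : set V) : Prop :=
  (forall i, (i < n)%N -> B (e i) /\ e i != 0) /\
  (forall i j, (i < n)%N -> (j < n)%N -> i != j -> H (e i) (e j) = 0).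

Lemma orthogonal_family_size n e b B : B `<=` W -> B `<=` lin_span [set` b] ->
  orthogonal_family n e B -> (n <= size b)%N.
Proof.
move=> BW Bb [eB eo]; rewrite leqNgt; apply/negP => bn.
have en (i : 'I_(size b).+1) : (i < n)%N by exact: leq_trans bn.
have We (i : 'I_(size b).+1) : W (e i) by apply: BW; have [] := eB i (en i).
have [u u0 ue] := lin_span_dependent (fun i : 'I_(size b).+1 => Bb _ (eB i (en i)).1).
move/eqP: u0; apply; apply/rowP => k; rewrite mxE; apply/eqP.
have := congr1 (H^~ (e k)) ue; rewrite /= herm0l// herm_suml//; last first.
  by move=> i _; exact: subspaceZ.
rewrite (bigD1 k)//= big1 ?addr0 => [|i ik]; last first.
  by rewrite hermZl// eo ?mulr0//.
rewrite hermZl// => /eqP; rewrite mulf_eq0 => /orP[//|/eqP /(herm_eq0 (We k)) e0].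
by have [_] := eB k (en k); rewrite e0 eqxx.
Qed.

(** Orthogonal families in [B] have bounded length, and one of maximal length spans [B]; [y] is the
    projection of [x] along it. *)
Lemma orthogonal_decomposition B x : Defs.subspace B -> B `<=` W -> finite_dim B ->
  W x -> exists y z, [/\ B y, W z, (forall u, B u -> H z u = 0) & x = y + z].
Proof.
move=> sB BW [b Bb] Wx.
pose P n := `[< exists e, orthogonal_family n e B >].
have P0 : exists n, P n by exists 0%N; apply/asboolP; exists (fun=> 0).
have Pb n : P n -> (n <= size b)%N.
  by move=> /asboolP[e]; exact: orthogonal_family_size.
case: (ex_maxnP P0 Pb) => n /asboolP[e [eB eo]] nmax.
have We i : (i < n)%N -> W (e i) by move=> /eB[/BW].
have Wo (i : 'I_n) : W (e i) by exact: We.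
pose proj v := \sum_(i < n) (H v (e i) / H (e i) (e i)) *: e i.
have Bproj v : B (proj v).
  by apply: subspace_sum => // i _ _; apply: subspaceZ => //; case: (eB i (ltn_ord i)).
have oproj v k : W v -> (k < n)%N -> H (v - proj v) (e k) = 0.
  move=> Wv kn; rewrite -[v - _]addrC -scaleN1r.
  have Wp : W (proj v) := BW _ (Bproj v).
  have Wk := We k kn.
  rewrite hermDl//; last exact: subspaceZ.
  rewrite hermZl// /proj herm_suml//; last first.
    by move=> i _; exact: subspaceZ.
  rewrite (bigD1 (Ordinal kn))//= big1 => [|i ik]; last first.
    by rewrite hermZl// (eo i k) ?mulr0//.
  rewrite hermZl// addr0 divfK ?mulN1r ?addNr//.
  by apply/eqP => /(herm_eq0 (We _ kn)); apply/eqP; case: (eB k kn).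
(* A nonzero [u] could be appended at position [n], contradicting maximality. *)
have Bmax u : B u -> (forall k, (k < n)%N -> H u (e k) = 0) -> u = 0.
  move=> Bu ue; apply/eqP/negP => /negP u0.
  suff : (n.+1 <= n)%N by rewrite ltnn.
  apply: nmax; apply/asboolP; exists (fun i => if (i < n)%N then e i else u); split.
    by move=> i _; case: ifP => [/eB//|_]; split.
  move=> i k; rewrite !ltnS => iN kN; case: ltnP => ii; case: ltnP => kk ik.
  - exact: eo.
  - by rewrite hermC ?(ue i) ?conjc0//; first [exact: We|exact: BW].
  - exact: ue.
  - by move: ik; rewrite eqn_leq (leq_trans iN kk) (leq_trans kN ii).
have uproj u : B u -> u = proj u.
  move=> Bu; apply/subr0_eq/Bmax; first exact: subspaceB.
  by move=> k kn; apply: oproj => //; exact: BW.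
have Wz : W (x - proj x) by apply: subspaceB => //; exact: BW.
have zk (i : 'I_n) : H (x - proj x) (e i) = 0 := oproj x i Wx (ltn_ord i).
exists (proj x), (x - proj x); split => //; last by rewrite subrKC.
move: (x - proj x) Wz zk => z Wz zk.
move=> u Bu; rewrite hermC//; last exact: BW.
rewrite (uproj u Bu) /proj herm_suml//; last first.
  by move=> i _; exact: subspaceZ.
rewrite big1 ?conjc0// => i _; rewrite hermZl//.
by rewrite [H (e i) z]hermC// zk conjc0 mulr0.
Qed.

Section Spectral.
Variable T : V -> V.
Hypotheses (lT : linear T) (TW : forall x, W x -> W (T x)).
Hypothesis Tsym : forall x y, W x -> W y -> H (T x) y = H x (T y).

Notation k := (fun lambda : R => eigenspace_on W T (real_complex R lambda)).

Lemma eigenspace_subspace (a : C) : Defs.subspace (eigenspace_on W T a).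
Proof.
split; first by split=> //; rewrite (linear_fun0 lT) scaler0.
move=> c x y [Wx Tx] [Wy Ty]; split; first by case: sW => _; exact.
by rewrite lT Tx Ty scalerDr !scalerA mulrC.
Qed.

Lemma eigenvalue_real (a : C) v : v != 0 -> eigenspace_on W T a v -> complex.Im a = 0.
Proof.
move=> v0 [Wv Tv]; have := Tsym Wv Wv; rewrite Tv hermZl// hermZr//.
have Hv : H v v != 0 by apply: contra_neq v0; exact: herm_eq0.
move=> /(mulIf Hv); case: a {Tv} => a b [/eqP].
by rewrite -addr_eq0 -mulr2n mulrn_eq0 => /eqP.
Qed.

Lemma eigenspaces_orthogonal lambda mu u v : lambda != mu ->
  k lambda u -> k mu v -> H u v = 0.
Proof.
move=> lm [Wu Tu] [Wv Tv]; have := Tsym Wu Wv.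
rewrite Tu Tv hermZl// hermZr// conjc_real => /eqP.
rewrite -subr_eq0 -mulrBl mulf_eq0 -rmorphB /= => /orP[/eqP/complexI/eqP|/eqP//].
by rewrite subr_eq0 (negPf lm).
Qed.

Definition eigensum (w : V) (s : seq R) (v : R -> V) : Prop :=
  [/\ uniq s, forall l, l \in s -> k l (v l) & w = \sum_(l <- s) v l].

(** Induction on the annihilating factors: (T - a) w is already a sum of eigenvectors, and T - a is
    inverted on those with eigenvalue other than a. What remains of [w] is an eigenvector for a. *)
Lemma spectral_decomposition w : finite_dim W -> W w -> exists s v, eigensum w s v.
Proof.
move=> fW Ww; have [q] := annihilating_product lT TW fW Ww.
elim: q w Ww => [|a q IH] w Ww /=.
  by move=> ->; exists [::], (fun=> 0); split; rewrite ?big_nil.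
set w1 := T w - a *: w => /IH[|s [v [us vs w1E]]].
  by apply: subspaceB => //; [exact: TW|exact: subspaceZ].
pose b l := real_complex R l - a.
have bE l u : k l u -> T u - a *: u = b l *: u.
  by move=> [_ ->]; rewrite -scalerBl.
have b0 l : b l = 0 -> a = real_complex R l by move=> /subr0_eq.
pose v' l := (b l)^-1 *: v l.
have kv' l : l \in s -> k l (v' l).
  by move=> ls; apply: subspaceZ; [exact: eigenspace_subspace|exact: vs].
pose s1 := [seq l <- s | b l != 0].
pose w2 := w - \sum_(l <- s1) v' l.
pose u := \sum_(l <- s | b l == 0) v l.
have Ww2 : W w2.
  apply: subspaceB => //; apply: subspace_sum => // l + _.
  by rewrite mem_filter => /andP[_ /kv'[]].
have Tw2 : T w2 - a *: w2 = u.
  have -> : T w2 - a *: w2 = w1 - \sum_(l <- s1) (T (v' l) - a *: v' l).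
    rewrite (linear_funB lT) scalerBr sumrB -scaler_sumr.
    have -> : T (\sum_(l <- s1) v' l) = \sum_(l <- s1) T (v' l).
      elim/big_ind2 : _ => [|x1 x2 y1 y2 <- <-|//]; first exact: linear_fun0.
      exact: linear_funD.
    by rewrite /w1 !opprB addrACA [RHS]addrACA; congr (_ + _); rewrite addrC.
  rewrite w1E (bigID (fun l => b l == 0))/= big_filter.
  rewrite [X in _ - X](_ : _ = \sum_(l <- s | b l != 0) v l) ?addrK//.
  rewrite big_seq_cond [RHS]big_seq_cond; apply: eq_bigr => l /andP[ls bl].
  by rewrite (bE _ _ (kv' l ls)) /v' scalerA divff ?scale1r.
have ku : eigenspace_on W T a u.
  apply: subspace_sum; first exact: eigenspace_subspace.
  by move=> l ls /eqP /b0 ->; exact: vs.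
(* If u is nonzero then a is real, and by symmetry H(u, u) = H((T - a) w2, u) = H(w2, (T - a) u) =
   0: a symmetric operator has no Jordan blocks. *)
have u0 : u = 0.
  have [//|un0] := eqVneq u 0.
  have Ia := eigenvalue_real un0 ku; have [Wu Tu] := ku.
  apply: herm_eq0 => //; rewrite -{1}Tw2 -scaleNr hermDl//; last 2 first.
  - exact: TW.
  - exact: subspaceZ.
  rewrite Tsym// hermZl// Tu hermZr//.
  by case: (a) Ia => x y /= ->; rewrite oppr0 -mulrDl subrr mul0r.
have kw2 : eigenspace_on W T a w2.
  by split => //; apply/subr0_eq; rewrite Tw2.
have [w20|w2n0] := eqVneq w2 0.
  exists s1, v'; split; first exact: filter_uniq.
  - by move=> l; rewrite mem_filter => /andP[_]; exact: kv'.
  - by apply/eqP; rewrite -subr_eq0; apply/eqP.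
have Ia := eigenvalue_real w2n0 kw2.
have aE : a = real_complex R (complex.Re a) by move: Ia; case: (a) => x y /= ->.
have as1 : complex.Re a \notin s1.
  by rewrite mem_filter negb_and negbK /b {2}aE subrr eqxx.
exists (complex.Re a :: s1), (fun l => if l == complex.Re a then w2 else v' l); split.
- by rewrite /= as1 filter_uniq.
- move=> l; rewrite inE; case: eqP => [-> _|_ /=]; first by rewrite -aE.
  by rewrite mem_filter => /andP[_]; exact: kv'.
rewrite big_cons eqxx big_seq_cond.
under eq_bigr => l /andP[ls _].
  rewrite (_ : l == _ = false); last by apply: contraNF as1 => /eqP <-.
over.
by rewrite -big_seq_cond /w2 subrK.
Qed.

Lemma eigensum_eq0 s v : eigensum 0 s v -> forall l, l \in s -> v l = 0.
Proof.
move=> [us vs /esym v0] l ls; have [Wl _] := vs l ls.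
apply: herm_eq0 => //; have := congr1 (H^~ (v l)) v0; rewrite /= herm0l//.
rewrite herm_suml//; last by move=> i /vs[].
rewrite (bigD1_seq l)//= big_seq_cond big1 ?addr0// => i /andP[si il].
by apply: (eigenspaces_orthogonal il); exact: vs.
Qed.

(** The index set [P] is left free to serve both decompositions: all nonzero eigenvalues in general,
    the negative ones in the equivariant case. *)
Lemma spectral_direct_sum (P : set R) : finite_dim W -> ~ P 0 ->
  (forall l v, l != 0 -> ~ P l -> k l v -> v = 0) ->
  is_direct_sum W (k 0) P k.
Proof.
move=> fW P0 Pk; split.
- exact: eigenspace_subspace.
- by move=> l _; exact: eigenspace_subspace.
- apply/seteqP; split=> [w Ww|_ [a [s [v [[Wa _] us vs ->]]]]]; last first.
    apply: subspaceD => //; apply: subspace_sum => // l ls _.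
    by have [_ []] := vs l ls.
  have [s [v [us vs wE]]] := spectral_decomposition fW Ww.
  exists (\sum_(l <- s | l == 0) v l), [seq l <- s | `[< P l >]], v; split.
  + apply: subspace_sum; first exact: eigenspace_subspace.
    by move=> l ls /eqP l0; have := vs l ls; rewrite l0.
  + exact: filter_uniq.
  + by move=> l; rewrite mem_filter => /andP[/asboolP Pl ls]; split => //; exact: vs.
  rewrite wE big_filter (bigID (fun l => l == 0))/=; congr (_ + _).
  have nP : \sum_(l <- s | (l != 0) && ~~ `[< P l >]) v l = 0.
    rewrite big_seq_cond big1// => l /and3P[ls l0 /asboolPn nP].
    exact: Pk (vs l ls).
  rewrite [LHS](bigID (fun l => `[< P l >]))/= nP addr0.
  apply: eq_bigl => l; case: asboolP; rewrite ?andbF ?andbT// => Pl.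
  by apply/eqP => l0; apply: P0; rewrite -l0.
- move=> a s v ka us vs e.
  have ns0 : 0 \notin s by apply/negP => /vs[].
  (* The summand [a] becomes the component of eigenvalue 0, so that directness reduces to
     [eigensum_eq0]. *)
  pose v' l := if l == 0 then a else v l.
  have vE l : l \in s -> v' l = v l.
    by rewrite /v'; case: eqP => // ->; rewrite (negPf ns0).
  have H0 : eigensum 0 (0 :: s) v'.
    split=> [|l|]; first by rewrite /= ns0.
      by rewrite inE /v'; case: eqP => [-> _|_ /= /vs[]//].
    rewrite big_cons {1}/v' eqxx -[LHS]e; congr (_ + _).
    by rewrite big_seq_cond [RHS]big_seq_cond; apply: eq_bigr => l /andP[/vE ->].
  split; first by have := eigensum_eq0 H0 (mem_head _ _); rewrite /v' eqxx.
  by move=> l ls; rewrite -vE//; apply: (eigensum_eq0 H0); rewrite inE ls orbT.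
Qed.

End Spectral.
End HermitianForms.

(** * Complexified Lie algebras *)

Section ComplexifiedBracket.
Variables (R : realType) (V : lmodType R) (br : V -> V -> V).
Hypothesis brP : lie_algebra_axioms br.
Local Notation VC := (complexification V).
Implicit Types (a x y : V) (z w : VC).

Let brl x : linear (br x). Proof. by case: brP. Qed.
Let brr y : linear (br^~ y). Proof. by case: brP. Qed.

Lemma lie_anti x y : br x y = - br y x.
Proof.
have [_ _ b0 _] := brP; have := b0 (x + y).
rewrite (linear_funD (brl _)) !(linear_funD (brr _)) !b0 add0r addr0.
by rewrite addrC => /eqP; rewrite addr_eq0 => /eqP.
Qed.

Lemma lie_derivation a x y : br a (br x y) = br (br a x) y + br x (br a y).
Proof.
have [_ _ _ jac] := brP; have /eqP := jac a x y.
rewrite -addrA addr_eq0 => /eqP->.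
rewrite (lie_anti y (br a x)) (lie_anti y a) (linear_funN (brl x)).
by rewrite -opprD opprK addrC.
Qed.

Lemma bracketC_linear_r z : linear (bracketC br z).
Proof.
move=> c w w'; have D u v : bracketC br z (u + v) = bracketC br z u + bracketC br z v.
  congr (_, _); rewrite /= !(linear_funD (brl _)) ?opprD; exact: addrACA.
have Z u : bracketC br z (c *: u) = c *: bracketC br z u.
  congr (_, _); rewrite /= ?(linear_funB (brl _)) ?(linear_funD (brl _))
    !(linear_funZ (brl _)) !(scalerBr, scalerDr) ?opprD; exact: addrACA.
by rewrite D Z.
Qed.

Lemma bracketC_anti z w : bracketC br z w = - bracketC br w z.
Proof.
congr (_, _); rewrite /= (lie_anti z.1) (lie_anti z.2) ?opprD//.
by rewrite addrC.
Qed.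

Lemma bracketC_linear_l w : linear ((bracketC br)^~ w).
Proof.
move=> c z z'; rewrite /= bracketC_anti bracketC_linear_r opprD -scalerN.
by rewrite -!bracketC_anti.
Qed.

Lemma bracketC_toVC a z : bracketC br (toVC a) z = (br a z.1, br a z.2).
Proof. by rewrite /bracketC /= !(linear_fun0 (brr _)) subr0 addr0. Qed.

Lemma iadE a z : iad br a z = (- br a z.2, br a z.1).
Proof.
rewrite /iad bracketC_toVC; congr (_, _) => /=.
  by rewrite scale0r scale1r add0r.
by rewrite scale0r scale1r add0r.
Qed.

Lemma iad_linear a : linear (iad br a).
Proof.
move=> c z w; rewrite /iad bracketC_linear_r scalerDr !scalerA.
by rewrite mulrC.
Qed.

Lemma iad_derivation a z w :
  iad br a (bracketC br z w) = bracketC br (iad br a z) w + bracketC br z (iad br a w).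
Proof.
rewrite /iad (linear_funZ (bracketC_linear_l w)) (linear_funZ (bracketC_linear_r z)).
rewrite -scalerDr; congr (_ *: _); rewrite !bracketC_toVC; congr (_, _) => /=.
  rewrite (linear_funB (brl a)) !(lie_derivation a) opprD; exact: addrACA.
rewrite (linear_funD (brl a)) !(lie_derivation a); exact: addrACA.
Qed.

Lemma iad_eq0 a z : iad br a z = 0 <-> bracketC br (toVC a) z = 0.
Proof.
split=> [/eqP|]; last by rewrite /iad => ->; rewrite scaler0.
by rewrite /iad scaler_eq0 => /orP[/eqP[/eqP]|/eqP//]; rewrite oner_eq0.
Qed.

(** [br a] is skew for [kappa], hence skew-Hermitian after extension, and the factor i makes it
    symmetric. *)
Lemma iad_symmetric (kappa : V -> V -> R) a z w :
  (forall x, scalar (kappa x)) -> (forall y, scalar (kappa^~ y)) ->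
  (forall x y, kappa (br a x) y + kappa x (br a y) = 0) ->
  hermitian_ext kappa (iad br a z) w = hermitian_ext kappa z (iad br a w).
Proof.
move=> kr kl kinv.
have kE x y : kappa (br a x) y = - kappa x (br a y).
  by apply/eqP; rewrite -addr_eq0 kinv.
rewrite !iadE /hermitian_ext/= !(linear_funN (kr _)) !(linear_funN (kl _)) !kE.
by congr Complex; rewrite !opprK addrC.
Qed.

End ComplexifiedBracket.

Section ComplexifiedSubspaces.
Variables (R : realType) (V : lmodType R).
Local Notation VC := (complexification V).
Implicit Types A : set V.

Lemma complexify_subspace A : Defs.subspace A -> Defs.subspace (complexify_set A).
Proof.
move=> sA; split; first by case: sA.
move=> c z w [Az1 Az2] [Aw1 Aw2]; split=> /=.
  by apply: subspaceD => //; apply: subspaceB => //; exact: subspaceZ.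
by apply: subspaceD => //; apply: subspaceD => //; exact: subspaceZ.
Qed.

Lemma complexify_finite_dim A : finite_dim A -> finite_dim (complexify_set A).
Proof.
move=> [b Ab]; exists [seq toVC x | x <- b] => z.
move=> [/Ab/lin_span_seqP[p pz] /Ab/lin_span_seqP[q qz]].
exists [seq (Complex (p i) (q i), toVC b`_i) | i : 'I_(size b)]; split.
  move=> _ /mapP[i _ ->] /=; apply/mapP; exists b`_i => //; exact: mem_nth.
rewrite big_map big_enum/=.
have E (F : 'I_(size b) -> VC) : \sum_i F i = (\sum_i (F i).1, \sum_i (F i).2).
  elim/big_rec3 : _ => [//|i x y u _ ->]; by congr (_, _).
rewrite E/= [LHS]surjective_pairing pz qz; congr (_, _); apply: eq_bigr => i _ /=.
  by rewrite scaler0 subr0.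
by rewrite scaler0 add0r.
Qed.

Lemma hermitian_ext_on A (B : V -> V -> R) : Defs.subspace A ->
  (forall a x y z, A x -> A y -> A z -> B (a *: x + y) z = a * B x z + B y z) ->
  (forall x y, A x -> A y -> B x y = B y x) ->
  (forall x, A x -> x != 0 -> 0 < B x x) ->
  hermitian_on (hermitian_ext B) (complexify_set A).
Proof.
move=> sA Bl Bs Bp.
have A0 : A 0 by case: sA.
have B0 z : A z -> B 0 z = 0.
  by move=> Az; have := Bl (-1) 0 0 z A0 A0 Az; rewrite scaler0 addr0 mulN1r addNr.
have BD x y z : A x -> A y -> A z -> B (x + y) z = B x z + B y z.
  by move=> Ax Ay Az; have := Bl 1 x y z Ax Ay Az; rewrite scale1r mul1r.
have BZ a x z : A x -> A z -> B (a *: x) z = a * B x z.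
  by move=> Ax Az; rewrite -[a *: x]addr0 Bl// B0// addr0.
have AZ a x : A x -> A (a *: x) by exact: subspaceZ.
have AD x y : A x -> A y -> A (x + y) by exact: subspaceD.
have AN x : A x -> A (- x) by exact: subspaceN.
split.
- move=> [a b] [x1 x2] [y1 y2] [z1 z2] [/= Ax1 Ax2] [/= Ay1 Ay2] [/= Az1 Az2].
  rewrite /hermitian_ext/= -!scaleNr.
  by congr Complex; rewrite !BD ?BZ//; try (do ?apply: AD => //; exact: AZ); ring.
- move=> [x1 x2] [y1 y2] [/= Ax1 Ax2] [/= Ay1 Ay2].
  rewrite /hermitian_ext/= (Bs x1 y1)// (Bs x2 y2)// (Bs x2 y1)// (Bs x1 y2)//.
  by rewrite opprB.
- move=> [x1 x2] [/= Ax1 Ax2] x0.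
  rewrite ltcE/= (Bs x2 x1)// subrr eqxx/=.
  have Bp' x : A x -> 0 <= B x x.
    by move=> Ax; have [->|/(Bp _ Ax)/ltW//] := eqVneq x 0; rewrite B0.
  have [x10|/(Bp _ Ax1) H1] := eqVneq x1 0; last by rewrite ltr_pwDl// Bp'.
  have [x20|/(Bp _ Ax2) H2] := eqVneq x2 0; last by rewrite ltr_wpDl// Bp'.
  by move: x0; rewrite x10 x20 eqxx.
Qed.

End ComplexifiedSubspaces.

(** * Reductive subalgebras *)

Section Reductive.
Variables (R : realType) (V : lmodType R) (br : V -> V -> V).
Hypothesis brP : lie_algebra_axioms br.
Local Notation VC := (complexification V).

(** The complementary ideal is the orthogonal complement for the Hermitian extension of the
    invariant inner product, as in Weyl's unitary trick. *)
Lemma complexify_reductive (A : set V) :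
  compact_subalgebra br A -> reductive (bracketC br) (complexify_set A).
Proof.
move=> [[sA brA] fA [B [Bl Bs Bp Binv]]].
have sAC := complexify_subspace sA.
have HP := hermitian_ext_on sA Bl Bs Bp.
have brAC z w : complexify_set A z -> complexify_set A w ->
    complexify_set A (bracketC br z w).
  move=> [z1 z2] [w1 w2]; split => /=.
    by apply: subspaceB => //; exact: brA.
  by apply: subspaceD => //; exact: brA.
split=> // I [sI IA Iid].
pose I' := [set z | complexify_set A z /\ forall u, I u -> hermitian_ext B z u = 0].
have fI : finite_dim I by apply: finite_dimS IA _; exact: complexify_finite_dim.
(* For the Hermitian extension of B, the adjoint of ad z is - ad (bar z). *)
pose bar (z : VC) : VC := (z.1, - z.2).
have Abar z : complexify_set A z -> complexify_set A (bar z).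
  by move=> [z1 z2]; split=> //=; exact: subspaceN.
have BN x z : A x -> A z -> B (- x) z = - B x z.
  move=> Ax Az; have [A0 _] := sA; have := Bl (-1) x x z Ax Ax Az.
  have := Bl (-1) x 0 z Ax A0 Az; have := Bl (-1) 0 0 z A0 A0 Az.
  by rewrite scaler0 !addr0 !scaleN1r !mulN1r addNr => -> ->; rewrite addr0.
have BD x y z : A x -> A y -> A z -> B (x + y) z = B x z + B y z.
  by move=> Ax Ay Az; have := Bl 1 x y z Ax Ay Az; rewrite scale1r mul1r.
have BNr x z : A x -> A z -> B x (- z) = - B x z.
  by move=> Ax Az; rewrite Bs ?BN ?(Bs z)//; exact: subspaceN.
have BDr x y z : A x -> A y -> A z -> B x (y + z) = B x y + B x z.
  by move=> Ax Ay Az; rewrite Bs ?BD ?(Bs x)//; exact: subspaceD.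
have inv x y z : complexify_set A x -> complexify_set A y -> complexify_set A z ->
    hermitian_ext B (bracketC br x y) z = - hermitian_ext B y (bracketC br (bar x) z).
  move=> [x1 x2] [y1 y2] [z1 z2]; have [_ brr _ _] := brP.
  have E u v w : A u -> A v -> A w -> B (br u v) w = - B v (br u w).
    by move=> Au Av Aw; apply/eqP; rewrite -addr_eq0 Binv.
  have AN u : A u -> A (- u) by exact: subspaceN.
  have Abr u v : A u -> A v -> A (br u v) by exact: brA.
  have AND u v : A u -> A v -> A (- br u v) by move=> Au Av; exact/AN/Abr.
  rewrite /hermitian_ext/= !(linear_funN (brr _)) ?opprK.
  rewrite !(BD, BDr, BN, BNr, E); auto.
  by apply/eqP; rewrite eq_complex /=; apply/andP; split; apply/eqP; ring.
exists I'; split.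
- split=> [|z []//|x y Ax [Ay yI]].
    split; first by have [A0 _] := sAC; split=> // u /IA; exact: (herm0l sAC HP).
    move=> c x y [Ax xI] [Ay yI]; split; first by have [_] := sAC; exact.
    move=> u Iu; have Au := IA _ Iu; have [HL _ _] := HP.
    by rewrite HL// xI// yI// mulr0 addr0.
  split; first exact: brAC.
  move=> u Iu; rewrite inv//; last exact: IA.
  by rewrite yI ?oppr0//; apply: Iid => //; exact: Abar.
- apply/seteqP; split=> [z [Iz [Az zI]]|_ ->].
    by apply: (herm_eq0 HP) => //; exact: zI.
  split; first by case: sI.
  by have [A0 _] := sAC; split=> // u /IA; exact: (herm0l sAC HP).
move=> x Ax; have [y [z [Iy Az zI xE]]] := orthogonal_decomposition sAC HP sI IA fI Ax.
by exists y, z.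
Qed.

Section MaximalReductive.
Variables (a : V) (W h : set VC) (H : VC -> VC -> R[i]).
Hypotheses (HP : hermitian_on H W) (fW : finite_dim W).
Hypothesis Tsym : forall x y, W x -> W y -> H (iad br a x) y = H x (iad br a y).
Hypothesis eig_le0 : forall l : R, 0 < l -> forall v,
  eigenspace_on W (iad br a) (real_complex R l) v -> v = 0.
Hypotheses (hred : reductive (bracketC br) h) (hW : h `<=` W) (ha : h (toVC a)).

Notation T := (iad br a).
Notation k := (fun l : R => eigenspace_on h T (real_complex R l)).

Let lT : linear T. Proof. exact: iad_linear. Qed.
Let sh : Defs.subspace h. Proof. by case: hred => -[]. Qed.
Let brh x y : h x -> h y -> h (bracketC br x y).
Proof. by case: hred => -[_ +] _; exact. Qed.
Let Th x : h x -> h (T x).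
Proof. by move=> hx; apply: subspaceZ => //; exact: brh. Qed.
Let fh : finite_dim h. Proof. exact: finite_dimS fW. Qed.

Let HPh : hermitian_on H h. Proof. exact: hermitian_onS HP. Qed.

Let Tsymh x y : h x -> h y -> H (T x) y = H x (T y).
Proof. by move=> hx hy; apply: Tsym; exact: hW. Qed.

Let k_le0 (l : R) v : k l v -> v != 0 -> l <= 0.
Proof.
move=> [hv Tv]; rewrite leNgt; apply: contra_neqN => /eig_le0; apply; split=> //.
exact: hW.
Qed.

Let brk (l mu : R) x y : k l x -> k mu y -> k (l + mu) (bracketC br x y).
Proof.
move=> [hx Tx] [hy Ty]; split; first exact: brh.
rewrite iad_derivation// Tx Ty (linear_funZ (bracketC_linear_l brP _)).
by rewrite (linear_funZ (bracketC_linear_r brP _)) -scalerDl -rmorphD.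
Qed.

Let sum_bracket_l s (v : R -> VC) y :
  bracketC br (\sum_(l <- s) v l) y = \sum_(l <- s) bracketC br (v l) y.
Proof.
elim/big_rec2 : _ => [|l u w _ <-]; first exact: (linear_fun0 (bracketC_linear_l brP y)).
exact: (linear_funD (bracketC_linear_l brP y)).
Qed.

Let sum_bracket_r s (v : R -> VC) y :
  bracketC br y (\sum_(l <- s) v l) = \sum_(l <- s) bracketC br y (v l).
Proof.
elim/big_rec2 : _ => [|l u w _ <-]; first exact: (linear_fun0 (bracketC_linear_r brP y)).
exact: (linear_funD (bracketC_linear_r brP y)).
Qed.

(* By self-adjointness, the sum of the eigenspaces with negative eigenvalue. *)
Let n := [set y | h y /\ forall z, k 0 z -> H y z = 0].

Let n_eigensum y : n y -> exists s v,
  [/\ eigensum h T y s v & forall l, l \in s -> v l != 0 -> l < 0].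
Proof.
move=> [hy yn]; have [s [v yE]] := spectral_decomposition sh HPh lT Th Tsymh fh hy.
exists s, v; split=> // l ls vl0; have [us vs ysum] := yE.
rewrite lt_neqAle (k_le0 (vs l ls) vl0) andbT; apply: contra_neq vl0 => l0.
have kv := vs l ls; have kv0 : k 0 (v l) by move: kv; rewrite l0.
have [hv _] := kv; apply: (herm_eq0 HPh) => //.
(* The component of eigenvalue 0 pairs with itself exactly as [y] does, that is, to 0. *)
rewrite -[RHS](yn _ kv0) ysum (herm_suml sh HPh)//; last by move=> i /vs[].
rewrite (bigD1_seq l)//= big_seq_cond big1 ?addr0// => i /andP[si il].
by apply: (eigenspaces_orthogonal sh HPh Tsymh il) => //; exact: vs.
Qed.

(** Brackets add eigenvalues, and no eigenvalue on [h] is positive, so bracketing with [h] keeps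
    negative eigenvalues negative. *)
Let n_ideal : lie_ideal (bracketC br) h n.
Proof.
split=> [|y []//|x y hx ny].
  split; first by have [h0 _] := sh; split=> // z [hz _]; exact: (herm0l sh HPh).
  move=> c x y [hx xn] [hy yn]; split; first by have [_] := sh; exact.
  move=> z kz; have [hz _] := kz; case: HPh => Hl _ _.
  by rewrite Hl// xn// yn// mulr0 addr0.
split; first by apply: brh => //; case: ny.
move=> z kz; have [hz _] := kz.
have [s [v [[us vs yE] vneg]]] := n_eigensum ny.
have [s' [v' [us' vs' xE]]] := spectral_decomposition sh HPh lT Th Tsymh fh hx.
rewrite yE sum_bracket_r (herm_suml sh HPh)//; last first.
  by move=> l /vs[hv _]; exact: brh.
rewrite big_seq big1// => l ls; rewrite xE sum_bracket_l (herm_suml sh HPh)//; last first.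
  by move=> i /vs'[hv _]; apply: brh => //; case: (vs l ls).
rewrite big_seq big1// => i is'.
have [vl0|vl0] := eqVneq (v l) 0.
  by rewrite vl0 (linear_fun0 (bracketC_linear_r brP _)) (herm0l sh HPh).
have [vi0|vi0] := eqVneq (v' i) 0.
  by rewrite vi0 (linear_fun0 (bracketC_linear_l brP _)) (herm0l sh HPh).
apply: (eigenspaces_orthogonal sh HPh Tsymh _ (brk (vs' i is') (vs l ls)) kz).
by rewrite lt_eqF// ltr_wnDl// ?(k_le0 (vs' i is'))// vneg.
Qed.

Lemma reductive_sub_kernel x : h x -> k 0 x.
Proof.
have [_ /(_ n n_ideal)[B [[sB Bh Bid] nB0 nBh]]] := hred.
have [y [z [ny Bz aE]]] := nBh _ ha.
have neg0 (l : R) v : l < 0 -> k l v -> v = 0.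
  move=> l0 kv; have [hv Tv] := kv.
  have nv : n v.
    split=> // u ku; apply: (eigenspaces_orthogonal sh HPh Tsymh _ kv ku).
    by rewrite lt_eqF.
  have zv0 : bracketC br z v = 0.
    have : (n `&` B) (bracketC br z v).
      split; first by have [_ _ +] := n_ideal; apply=> //; exact: Bh.
      by rewrite bracketC_anti//; apply: subspaceN => //; exact: Bid.
    by rewrite nB0.
  have Tv' : T v = (Complex 0 1 : R[i]) *: bracketC br y v.
    by rewrite /iad aE (linear_funD (bracketC_linear_l brP v)) zv0 addr0.
  have [s [w [[us ws yE] wneg]]] := n_eigensum ny.
  apply: (herm_eq0 HPh) => //.
  have hyv : h (bracketC br y v) by apply: brh => //; case: ny.
  (* All components of [y] have negative eigenvalue, so [bracketC br y v] lives in eigenvalues below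
     [l] and is orthogonal to [v]; but [T v] is also [l] times [v]. *)
  have : H (T v) v = 0.
    rewrite Tv' (hermZl sh HPh)// yE sum_bracket_l (herm_suml sh HPh)//; last first.
      by move=> i /ws[hw _]; exact: brh.
    rewrite big_seq big1 ?mulr0// => i is_.
    have [wi0|wi0] := eqVneq (w i) 0.
      by rewrite wi0 (linear_fun0 (bracketC_linear_l brP _)) (herm0l sh HPh).
    apply: (eigenspaces_orthogonal sh HPh Tsymh _ (brk (ws i is_) kv) kv).
    by rewrite lt_eqF// gtrDr wneg.
  rewrite Tv (hermZl sh HPh)// => /eqP; rewrite mulf_eq0 => /orP[/eqP|/eqP//].
  by move=> /(@complexI R _ 0) l00; rewrite l00 ltxx in l0.
move=> hx; have [s [v [us vs xE]]] := spectral_decomposition sh HPh lT Th Tsymh fh hx.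
rewrite xE; apply: subspace_sum; first exact: eigenspace_subspace.
move=> l ls _; have kv := vs l ls; have [vl0|vl0] := eqVneq (v l) 0.
  by rewrite vl0; case: (eigenspace_subspace sh lT (real_complex R 0)).
have := k_le0 kv vl0; rewrite le_eqVlt => /orP[/eqP <-//|l0].
by rewrite (neg0 l _ l0 kv) in vl0; rewrite eqxx in vl0.
Qed.

End MaximalReductive.
End Reductive.

(** * Decomposition of the complexified stabilizer *)

Section ComplexStabilizer.
Variables (R : realType) (EG EM : lmodType R) (br : EG -> EG -> EG) (a : EG).
Variables (D : EG -> EM) (j : EM -> EM).
Hypotheses (lD : linear D) (lj : linear j) (jj : forall v, j (j v) = - v).
Notation W := [set zeta : complexification EG | D zeta.1 + j (D zeta.2) = 0].

(** [W] is the kernel of a complex-linear map once i acts on [EM] through [j]. *)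
Lemma complex_kernel_subspace : Defs.subspace W.
Proof.
split=> [|c z w /= /eqP + /eqP].
  by rewrite /= (linear_fun0 lD) (linear_fun0 lj) addr0.
rewrite !addr_eq0 => /eqP z0 /eqP w0.
rewrite !(linear_funD lD) (linear_funN lD) !(linear_funZ lD) z0 w0.
rewrite !(linear_funD lj) !(linear_funZ lj) (linear_funN lj) jj opprK !scalerN.
by rewrite -!opprD addNr.
Qed.

Lemma complex_kernel_iad : lie_algebra_axioms br ->
  (forall xi eta, D xi + j (D eta) = 0 -> D (br a xi) + j (D (br a eta)) = 0) ->
  forall z, W z -> W (iad br a z).
Proof.
move=> brP H z /H /(congr1 j); rewrite (iadE brP) /= (linear_funD lj) jj (linear_fun0 lj).
by rewrite (linear_funN lD) addrC.
Qed.

End ComplexStabilizer.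

Theorem theorem4p2 (R : realType)
  (M : topologicalType) (EM : tvsType R) (mM : charted_space M EM)
  (omega : M -> EM -> EM -> R)
  (G : preTopologicalGroupType) (EG : tvsType R) (mG : charted_space G EG)
  (exp : EG -> G) (br : EG -> EG -> EG)
  (act : G -> M -> M) (j : M -> EM -> EM)
  (kappa : EG -> EG -> R) (J : M -> EG) (m : M) :
  frechet_manifold mM -> connected [set: M] -> symplectic_form mM omega ->
  lie_group mG -> exponential_map mG exp -> lie_bracket_of mG exp br ->
  symplectic_action mG mM act omega ->
  almost_complex_structure mM j -> compatible omega j ->
  inner_pairing kappa ->
  momentum_map mM act exp omega kappa J ->
  critical_point mM (fun x => kappa (J x) (J x)) m ->
  (forall v, tau' mM act exp j (J m) m v = 0) ->
  (forall xi eta, kappa (br (J m) xi) eta + kappa xi (br (J m) eta) = 0) ->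
  let gm := stabilizer mM act exp m in
  let gCm := stabilizerC mM act exp j m in
  (~ (finite_dim [set: EM] /\ finite_dim [set: EG]) ->
     [/\ forall xi, exists ad_star : EG -> EG, forall eta zeta,
           kappa (br xi eta) zeta = kappa eta (ad_star zeta),
         exists Sigma_kappa : EG -> EG, forall xi eta,
           kappa (Sigma_kappa xi) eta =
           noneq_cocycle mM act exp br omega kappa J m xi eta
       & finite_dim gCm]) ->
  let iadJ := iad br (J m) in
  let c := [set zeta | gCm zeta /\ bracketC br (toVC (J m)) zeta = 0] in
  let k := fun lambda : R => eigenspace_on gCm iadJ (real_complex R lambda) in
  let eigenvalue := fun lambda : R =>
    is_eigenvalue_on gCm iadJ (real_complex R lambda) in
  [/\ is_direct_sum gCm c [set lambda : R | lambda != 0] k,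
      forall a : R[i], c (a *: toVC (J m)),
      [/\ forall zeta, gCm zeta -> gCm (iadJ zeta),
          forall a : R[i], is_eigenvalue_on gCm iadJ a -> complex.Im a = 0
        & c = k 0],
      forall lambda mu : R,
        let S := bracket_span (bracketC br) (k lambda) (k mu) `&` gCm in
        (eigenvalue (lambda + mu) -> S `<=` k (lambda + mu)) /\
        (~ eigenvalue (lambda + mu) -> S = [set 0])
    & forall (lambda nu : R) zeta zeta', lambda != nu ->
        k lambda zeta -> k nu zeta' -> hermitian_ext kappa zeta zeta' = 0]
  /\
  (ad_equivariant mM act exp br J ->
     is_direct_sum gCm (complexify_set gm) [set lambda : R | lambda < 0] k
     /\
     (compact_subalgebra br gm ->
        [/\ reductive (bracketC br) (complexify_set gm),
            complexify_set gm `<=` gCm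
          & forall h : set (complexification EG),
              reductive (bracketC br) h -> h `<=` gCm ->
              complexify_set gm `<=` h -> h = complexify_set gm])).
Proof.
move=> MF _ omegaP LG expG brE actP jP [_ jpos] kappaP JP crit tauJ kinv.
move=> gm gCm fin iadJ c k eigenvalue.
have [brP _] := brE; have [brl brr _ _] := brP.
have [jl _ jj] := jP; have [_ _ kC kpos _] := kappaP.
pose D xi := inf_act mM act exp xi m.
have lD : linear D := inf_act_linear m omegaP kappaP JP.
have DJ : D (J m) = 0 := critical_stabilizer omegaP kappaP JP crit.
have sC : Defs.subspace gCm := complex_kernel_subspace lD (jl m) (jj m).
have TW z : gCm z -> gCm (iadJ z).
  apply: (complex_kernel_iad (D := D) (j := j m)) => // xi eta.
  exact: (stabilizerC_ad MF omegaP LG expG brE actP jP kappaP JP crit tauJ).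
have lT : linear iadJ by exact: iad_linear.
have kr := kappa_linear_r kappaP; have kl := kappa_linear_l kappaP.
have HP : hermitian_on (hermitian_ext kappa) gCm.
  apply: (@hermitian_onS _ _ _ (complexify_set setT)) => //.
  apply: hermitian_ext_on => // [u x y z _ _ _|x _]; first exact: kl.
  exact: kpos.
have Tsym x y : gCm x -> gCm y ->
    hermitian_ext kappa (iadJ x) y = hermitian_ext kappa x (iadJ y).
  by move=> _ _; exact: iad_symmetric.
have fW : finite_dim gCm.
  (* In finite dimensions the whole of g_C is finite-dimensional; otherwise assumption (3)
     applies. *)
  have [[_ fE]|nf] := pselect (finite_dim [set: EM] /\ finite_dim [set: EG]).
    by apply: finite_dimS (complexify_finite_dim fE).
  by case: (fin nf).
have c0 : c = k 0.
  apply/seteqP; split=> z [gz].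
    by move=> /iad_eq0 bz; split; rewrite // scale0r.
  by rewrite scale0r => /iad_eq0.
split.
  split.
  - rewrite c0; apply: (spectral_direct_sum sC HP) => //=.
    by rewrite eqxx.
  - move=> z; rewrite c0; apply: subspaceZ.
      exact: eigenspace_subspace.
    rewrite -c0; split; last first.
      rewrite bracketC_toVC//= (linear_fun0 (brl _)).
      by have [_ _ -> _] := brP.
    rewrite /gCm/stabilizerC/inf_actC/= -!/(D _) DJ.
    by rewrite (linear_fun0 lD) (linear_fun0 (jl m)) addr0.
  - split=> // z [v v0 kv]; exact: (eigenvalue_real sC HP Tsym v0 kv).
  - move=> l mu S.
    have Sk : S `<=` k (l + mu).
      move=> z [Sz gz]; split => //.
      (* Individual brackets may leave the stabilizer, so the eigenvalue equation is proved in all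
         of g_C and intersected afterwards. *)
      suff : bracket_span (bracketC br) (k l) (k mu) `<=`
             eigenspace_on setT iadJ (real_complex R (l + mu)).
        by move=> /(_ z Sz)[].
      apply: lin_span_sub; first exact: eigenspace_subspace.
      move=> _ [x [y [[_ Tx] [_ Ty] ->]]]; split => //.
      rewrite /iadJ iad_derivation// -/iadJ Tx Ty.
      rewrite (linear_funZ (bracketC_linear_l brP _)).
      by rewrite (linear_funZ (bracketC_linear_r brP _)) -scalerDl -rmorphD.
    split=> // ne; apply/seteqP; split=> [z Sz|_ ->].
      have [//|z0] := eqVneq z 0; case: ne; exists z => //; exact: Sk.
    split; last by case: sC.
    by exists [::]; split=> //; rewrite big_nil.
  - by move=> l nu z z' ln; exact: (eigenspaces_orthogonal sC HP Tsym ln).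
move=> adJ.
have momE := momentumE m JP.
(* Both sides compute - omega(D z.2, D z.1): the stabilizer equation gives D z.1 = - j (D z.2),
   while equivariance and the eigenvalue equation give TJ (D z.1) = - l z.2. *)
have om_eig (l : R) z : k l z ->
    omega m (D z.2) (j m (D z.2)) = - (l * kappa z.2 z.2).
  move=> [/eqP]; rewrite addr_eq0 -/(D _) -/(D _) => /eqP Dz Tz.
  have e2 : br (J m) z.1 = l *: z.2.
    by move: Tz; rewrite /iadJ iadE// => -[_ ->] /=; rewrite scale0r addr0.
  have := momE z.2 (D z.1); rewrite adJ (lie_anti brP) e2.
  rewrite (linear_funN (kl _)) (linear_funZ (kl _)) opprK => e.
  have <- : omega m (D z.2) (D z.1) = l * kappa z.2 z.2 by [].
  by rewrite Dz (linear_funN (omega_linear_r m omegaP _)) opprK.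
have k_gt0 (l : R) z : 0 < l -> k l z -> z = 0.
  move=> l0 kz; have e := om_eig l z kz; have [_ Tz] := kz.
  have z20 : z.2 = 0.
    have [//|z2n] := eqVneq z.2 0; have kp := mulr_gt0 l0 (kpos _ z2n).
    have : 0 <= - (l * kappa z.2 z.2).
      rewrite -e; have [->|Dz] := eqVneq (D z.2) 0; last exact: ltW (jpos m _ Dz).
      by rewrite (linear_fun0 (omega_linear_l m omegaP _)).
    by rewrite oppr_ge0 leNgt kp.
  (* With z.2 = 0 the real component of the eigenvalue equation reads l z.1 = 0. *)
  move: Tz; rewrite /iadJ (iadE brP) z20 (linear_fun0 (brl _)) => -[/esym/eqP + _].
  rewrite /= z20 scaler0 subr0 oppr0 scaler_eq0 gt_eqF//= => /eqP z10.
  by rewrite [LHS]surjective_pairing z10 z20.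
(* For eigenvalue 0, [om_eig] and positivity force D z.2 = 0 and then D z.1 = 0. Conversely, D x = 0
   gives [J(m), x] = - TJ (D x) = 0. *)
have cg : c = complexify_set gm.
  apply/seteqP; split=> [z cz|z [z1 z2]].
    have kz : k 0 z by rewrite -c0.
    have [gz _] := kz; have Dz2 : D z.2 = 0.
      have [//|Dz] := eqVneq (D z.2) 0; have := jpos m _ Dz.
      by rewrite (om_eig 0 z kz) mul0r oppr0 ltxx.
    split=> //; move: gz; rewrite /gCm/stabilizerC/inf_actC/= -!/(D _) Dz2.
    by rewrite (linear_fun0 (jl m)) addr0.
  have br0 x : D x = 0 -> br (J m) x = 0.
    move=> Dx; rewrite (lie_anti brP) -adJ -/(D x) Dx tmap0 ?oppr0//.
    exact: (lie_group_hausdorff LG).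
  split; last by rewrite bracketC_toVC//; congr (_, _); exact: br0.
  rewrite /gCm/stabilizerC/inf_actC/= -!/(D _).
  by rewrite [D z.1]z1 [D z.2]z2 (linear_fun0 (jl m)) addr0.
split.
  rewrite -cg c0; apply: (spectral_direct_sum sC HP) => //=.
    by rewrite ltxx.
  move=> l v l0 /negP; rewrite -leNgt le_eqVlt eq_sym (negPf l0) /= => lp.
  exact: k_gt0.
move=> gmc; split.
- exact: complexify_reductive.
- by rewrite -cg => z [].
move=> h hred hg gh; apply/seteqP; split=> // x hx.
(* J(m) lies in g_m by criticality, so [h] contains the element whose adjoint action defines the
   grading. *)
have ha : h (toVC (J m)) by apply: gh; split=> //; exact: linear_fun0 lD.
have [_ Tx] := reductive_sub_kernel brP HP fW Tsym (fun l l0 v => k_gt0 l v l0)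
  hred hg ha hx.
by rewrite -cg c0; split=> //; exact: hg.
Qed.
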